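(* For each $\beta \in (0, \pi/2]$ and each $\nu > 0$, there exists $\theta \in \mathcal{A}$ such that $$E_\beta(\theta) = \inf_{\tilde\theta \in \mathcal{A}} E_\beta(\tilde\theta).$$ Furthermore, $\theta \in L^\infty(\mathbb{R}^+)$ and $\lim_{x \to \infty} \theta(x) = \theta_\infty$ for some $\theta_\infty \in \pi \mathbb{Z}$.
   Context: Notation: $\mathbb{R}^+ = (0,\infty)$ and $\overline{\mathbb{R}^+} = [0,\infty)$; all functions are real valued. $\mathring{H}^1_0(\mathbb{R}^+)$ is the Hilbert space obtained as the completion of $C^\infty_c(\mathbb{R}^+)$ with respect to the norm $\|u\|^2_{\mathring{H}^1_0(\mathbb{R}^+)} := \int_0^\infty |u'|^2\,dx$; its elements are identified with continuous functions on $[0,\infty)$ vanishing at $x=0$. For $\beta \in (0,\pi/2]$ the admissible class is $$\mathcal{A} := \{ \theta \in C(\overline{\mathbb{R}^+}) : \theta - \beta \in \mathring{H}^1_0(\mathbb{R}^+) \}.$$ For $\beta\in(0,\pi/2]$, $\eta_\beta : \mathbb{R} \to [0,\beta]$ is a fixed smooth cutoff function with $\eta_\beta(x) = \beta$ for $x \le 0$, $\eta_\beta(x) = 0$ for $x \ge 1$, and $\eta_\beta'(x) \le 0$ for all $x \in \mathbb{R}$. For $\beta \in (0,\pi/2]$, $\nu>0$ and $\theta \in \mathcal{A}$ the renormalized energy is $$E_\beta(\theta) = \int_0^\infty \left( \tfrac12 |\theta'|^2 + \tfrac12 \sin^2\theta + \frac{\nu}{4\pi}\cdot\frac{\sin^2(\theta-\beta)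 - \sin^2(\eta_\beta - \beta)}{x} \right) dx + \frac{\nu}{8\pi}\int_0^\infty\int_0^\infty \frac{(\sin(\theta(x)-\beta) - \sin(\theta(y)-\beta))^2}{(x-y)^2}\,dx\,dy - \frac{\nu}{8\pi}\int_0^\infty\int_0^\infty \frac{(\sin(\eta_\beta(x)-\beta) - \sin(\eta_\beta(y)-\beta))^2}{(x-y)^2}\,dx\,dy.$$ The integrand of the first integral is bounded from below by an integrable function not depending on $\theta$, the second term is nonnegative, and the last term is a finite constant, so $E_\beta(\theta) \in (-\infty,+\infty]$ is well defined on $\mathcal{A}$. *)

(* Defs.v *)
From HB Require Import structures.
From mathcomp Require Import all_boot all_order all_algebra.
From mathcomp Require Import all_classical all_reals all_analysis.

Set Implicit Arguments.
Unset Strict Implicit.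
Unset Printing Implicit Defensive.

Import Order.TTheory GRing.Theory Num.Theory.
Import numFieldNormedType.Exports.

Local Open Scope classical_set_scope.
Local Open Scope ring_scope.

Definition Rplus (R : realType) : set R := `]0, +oo[.
Definition Rplus_bar (R : realType) : set R := `[0, +oo[.
Arguments Rplus {R}.
Arguments Rplus_bar {R}.

Definition smooth (R : realType) (f : R -> R) : Prop :=
  forall (n : nat) (x : R), derivable (f^`(n))%classic x 1.

(* C^oo_c(R^+), each function being extended by 0 to the whole line. *)
Definition test_function (R : realType) (phi : R -> R) : Prop :=
  [/\ smooth phi,
      compact (closure [set x | phi x != 0]) &
      closure [set x | phi x != 0] `<=` Rplus].

(* Square of the norm of the homogeneous space, for smooth u. *)
Definition H10_normsq (R : realType) (u : R -> R) : \bar R :=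
  (\int[lebesgue_measure]_(x in Rplus) (((u^`())%classic x) ^+ 2)%:E)%E.

Definition H10_cauchy (R : realType) (phi : nat -> R -> R) : Prop :=
  forall e : R, 0 < e -> exists N : nat, forall m n : nat,
    (N <= m)%N -> (N <= n)%N -> (H10_normsq (phi m \- phi n)%R < (e ^+ 2)%:E)%E.

(* The completion of C^oo_c(R^+).  Since
     |phi x - phi y| <= `|x - y| ^ (1/2) * (\int |phi'|^2) ^ (1/2),
   a Cauchy sequence of test functions converges locally uniformly on [0, +oo[,
   equivalent sequences have the same limit, and the limit determines the
   class: a class is identified with its limit, which is continuous and
   vanishes at 0.  The values of u on ]-oo, 0[ are irrelevant. *)
Definition H10 (R : realType) (u : R -> R) : Prop :=
  exists phi : nat -> R -> R,
    [/\ forall n, test_function (phi n),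
        H10_cauchy phi &
        forall x : R, 0 <= x -> phi n x @[n --> \oo] --> u x].

Definition admissible (R : realType) (beta : R) : set (R -> R) :=
  [set theta : R -> R | {within Rplus_bar, continuous theta} /\
                        H10 (fun x => theta x - beta)].

Definition is_weak_derivative (R : realType) (u g : R -> R) : Prop :=
  locally_integrable Rplus g /\
  forall phi : R -> R, test_function phi ->
    (\int[lebesgue_measure]_(x in Rplus) (u x * (phi^`())%classic x)%:E =
     - \int[lebesgue_measure]_(x in Rplus) (g x * phi x)%:E)%E.

(* Every admissible function has a weak derivative, unique up to equality
   almost everywhere; the default value 0 is never used for such functions. *)
Definition weak_derivative (R : realType) (u : R -> R) : R -> R :=
  xget (fun=> 0) [set g | is_weak_derivative u g].

Definition cutoff (R : realType) (beta : R) (eta : R -> R) : Prop :=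
  [/\ smooth eta,
      forall x, 0 <= eta x <= beta,
      forall x : R, x <= 0 -> eta x = beta,
      forall x : R, 1 <= x -> eta x = 0 &
      forall x, (eta^`())%classic x <= 0].

Definition local_energy (R : realType) (beta nu : R) (eta theta : R -> R)
    : \bar R :=
  (\int[lebesgue_measure]_(x in Rplus)
    (2^-1 * `|weak_derivative theta x| ^+ 2 + 2^-1 * sin (theta x) ^+ 2
     + nu / (4 * pi) *
       ((sin (theta x - beta) ^+ 2 - sin (eta x - beta) ^+ 2) / x))%:E)%E.

(* The integrand takes the value 0 on the (negligible) diagonal. *)
Definition nonlocal_energy (R : realType) (beta : R) (f : R -> R) : \bar R :=
  (\int[lebesgue_measure]_(y in Rplus) \int[lebesgue_measure]_(x in Rplus)
    ((sin (f x - beta) - sin (f y - beta)) ^+ 2 / (x - y) ^+ 2)%:E)%E.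

Definition renormalized_energy (R : realType) (beta nu : R)
    (eta theta : R -> R) : \bar R :=
  (local_energy beta nu eta theta
   + (nu / (8 * pi))%:E * nonlocal_energy beta theta
   - (nu / (8 * pi))%:E * nonlocal_energy beta eta)%E.

(* Main.v *)
(** The direct method. By [sin^2 (t - b) - sin^2 b = sin t * sin (t - 2 b)] and Young's
    inequality, the local integrand plus an integrable function [H / (1 + x^2)] dominates
    [theta'^2 / 2 + sin^2 theta / 4]; hence the energy is, up to an additive constant, a sum
    of three nonnegative terms, and a minimizing sequence is bounded in the Dirichlet norm.
    Uniform Hoelder-1/2 bounds give a pointwise convergent subsequence. Fatou's lemma handles
    the potential and the nonlocal term; for the gradient term, and for the fact that the
    limit is again a limit of a Cauchy sequence of test functions, one replaces the sequence
    by almost minimal elements of the midpoint-convex hulls of its tails, which are Cauchy by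
    the parallelogram identity.

    A minimizer of finite energy is uniformly continuous with [sin theta] square integrable,
    so [sin theta --> 0] at infinity, and continuity forces [theta] to stay near a single
    multiple of [pi]. *)
Require Import Defs.
From HB Require Import structures.
From mathcomp Require Import all_boot all_order all_algebra.
From mathcomp Require Import all_classical all_reals all_analysis.
From mathcomp Require Import measurable_realfun ring lra.

Set Implicit Arguments.
Unset Strict Implicit.
Unset Printing Implicit Defensive.

Import Order.TTheory GRing.Theory Num.Theory.
Import numFieldNormedType.Exports.

Local Open Scope classical_set_scope.
Local Open Scope ring_scope.

(** * Smooth functions and test functions *)

(** The function [weak_derivative theta] is an unspecified choice, so nothing can be said about the
    gradient term before weak derivatives are known to be unique almost everywhere. This requires a
    supply of test functions, and the cutoff [eta] itself provides it: differences of two rescaled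
    translates of [eta] are test functions. Steep ones approximate indicators of intervals, which
    gives uniqueness; very flat ones have small Dirichlet energy, which gives an admissible function
    with limit 0.

    Compactness is argued on test functions only, where the derivative is classical: each term of
    the minimizing sequence is replaced by a test function that is close pointwise and has almost no
    more energy. Square-integral estimates are stated in the extended reals with a weighted Young
    inequality in the role of the triangle inequality, so that the same estimate yields both
    finiteness and limits. *)

Lemma smooth_derivable {R : realType} {f : R -> R} : smooth f ->
  forall x : R, derivable f x 1.
Proof. by move=> sf x; exact: (sf 0%N). Qed.

Lemma smooth_derive1 {R : realType} {f : R -> R} : smooth f -> smooth (derive1 f).
Proof. by move=> sf n x; rewrite -derive1Sn; exact: sf. Qed.

Lemma derivable_continuous {R : realType} {f : R -> R} :
  (forall x : R, derivable f x 1) -> continuous f.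
Proof.
by move=> df x; apply: differentiable_continuous; apply/derivable1_diffP.
Qed.

Lemma smooth_continuous {R : realType} {f : R -> R} : smooth f -> continuous f.
Proof. by move=> sf; exact/derivable_continuous/smooth_derivable. Qed.

Lemma derive1_lincomb {R : realType} (a b : R) (f g : R -> R) :
  (forall x : R, derivable f x 1) -> (forall x : R, derivable g x 1) ->
  derive1 (fun x => a * f x + b * g x) = fun x => a * derive1 f x + b * derive1 g x.
Proof.
move=> df dg; apply/funext => x; rewrite !derive1E.
have -> : (fun x => a * f x + b * g x) = a *: f + b *: g by apply/funext.
rewrite deriveD; [|exact: derivableZ|exact: derivableZ].
by rewrite !deriveZ.
Qed.

Lemma smooth_lincomb {R : realType} (a b : R) (f g : R -> R) :
  smooth f -> smooth g -> smooth (fun x => a * f x + b * g x).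
Proof.
move=> sf sg.
have E n : derive1n n (fun x => a * f x + b * g x) =
    fun x => a * derive1n n f x + b * derive1n n g x.
  elim: n => // n IH; rewrite derive1nS IH derive1_lincomb; last 2 first.
  - exact: sf.
  - exact: sg.
  by rewrite -!derive1nS.
move=> n x; rewrite E.
have -> : (fun x => a * derive1n n f x + b * derive1n n g x) =
  a *: derive1n n f + b *: derive1n n g by apply/funext.
by apply: derivableD; apply: derivableZ; [exact: sf|exact: sg].
Qed.

Lemma smoothB {R : realType} (f g : R -> R) : smooth f -> smooth g -> smooth (f \- g).
Proof.
move=> sf sg; have -> : f \- g = (fun x => 1 * f x + (- 1) * g x).
  by apply/funext => x /=; rewrite mul1r mulN1r.
exact: smooth_lincomb.
Qed.

Lemma is_derive_affine {R : realType} (f : R -> R) (a s x : R) :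
  derivable f ((x - a) / s) 1 ->
  is_derive x 1 (fun x => f ((x - a) / s)) (s^-1 * derive1 f ((x - a) / s)).
Proof.
move=> df.
have h : is_derive x 1 (fun x : R => (x - a) / s) s^-1.
  apply: is_derive_eq.
  by rewrite /= scaler0 add0r subr0 [LHS]mulr1.
rewrite mulrC; apply: (@is_derive1_comp _ f (fun x => (x - a) / s)).
by rewrite derive1E; exact: DeriveDef.
Qed.

Lemma derive1_affine {R : realType} (f : R -> R) (a s : R) :
  (forall x : R, derivable f x 1) ->
  derive1 (fun x => f ((x - a) / s)) = fun x => s^-1 * derive1 f ((x - a) / s).
Proof.
move=> df; apply/funext => x; rewrite derive1E.
by have [_ ->] := @is_derive_affine _ f a s x (df _).
Qed.

Lemma smooth_affine {R : realType} (f : R -> R) (a s : R) :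
  smooth f -> smooth (fun x => f ((x - a) / s)).
Proof.
move=> sf.
have E n : derive1n n (fun x => f ((x - a) / s)) =
    s^-1 ^+ n *: (fun x => derive1n n f ((x - a) / s)).
  elim: n => [|n IH]; first by rewrite expr0 scale1r.
  rewrite derive1nS IH; apply/funext => x; rewrite derive1E.
  have h := @is_derive_affine _ (derive1n n f) a s x (sf n _).
  rewrite deriveZ; last by case: h.
  have [_ ->] := h.
  by rewrite derive1nS exprSr -scalerA.
move=> n x; rewrite E; apply: derivableZ.
by case: (@is_derive_affine _ (derive1n n f) a s x (sf n _)).
Qed.

(** A nonempty compact subset of [Rplus] has a least and a greatest element, so it lies in a segment
    with positive left end. All later arguments on supports use this form. *)
Lemma test_functionP {R : realType} (phi : R -> R) :
  test_function phi <->
  smooth phi /\ exists a b : R, [/\ 0 < a, a < b &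
    forall x, phi x != 0 -> a <= x <= b].
Proof.
set S := [set x | phi x != 0].
split=> [[sp cp sub]|[sp [a [b [a0 ab ph]]]]]; last first.
  have sab : closure S `<=` `[a, b].
    rewrite closureEbigcap; apply: bigcap_inf; split; first exact: itv_closed.
    by move=> x /ph; rewrite /= in_itv.
  split => //.
    by apply: (subclosed_compact _ (@segment_compact _ a b) sab); exact: closed_closure.
  move=> x /sab; rewrite /Rplus /= !in_itv /= => /andP[ax _].
  by rewrite andbT (lt_le_trans a0).
split => //.
have [S0|/set0P S0] := eqVneq (closure S) set0.
  exists 1, 2; split => //; first by rewrite ltr1n.
  move=> x px; have : closure S x by exact: (@subset_closure _ S x px).
  by rewrite S0.
have [c cS cmin] : exists2 c : R, c \in closure S & forall t : R, t \in closure S -> c <= t.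
  by apply: (@compact_EVT_min _ _ id) => //; apply: continuous_subspaceT => ?; exact: cvg_id.
have [d dS dmax] : exists2 c : R, c \in closure S & forall t : R, t \in closure S -> t <= c.
  by apply: (@compact_EVT_max _ _ id) => //; apply: continuous_subspaceT => ?; exact: cvg_id.
(* The [+ 1] makes the two ends strictly ordered even if [c = d]. *)
exists c, (d + 1); split.
- by have := sub _ (set_mem cS); rewrite /Rplus /= in_itv /= andbT.
- by rewrite ltr_pwDr// cmin.
- move=> x px; have xS : x \in closure S by apply/mem_set/subset_closure.
  by rewrite cmin//= (le_trans (dmax _ xS))// lerDl.
Qed.

(** * Compactly supported integrands and the Dirichlet integral *)

Local Notation leb := lebesgue_measure.

(** Weaker than [test_function] so as to be stable under squares and under products with continuous
    functions: one integrability lemma then covers all integrands built from test functions. *)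
Definition csupp {R : realType} (f : R -> R) : Prop := continuous f /\
  exists a b : R, [/\ 0 < a, a < b & forall x, f x != 0 -> a <= x <= b].

Lemma measurable_Rplus {R : realType} : measurable (Rplus : set R).
Proof. exact: measurable_itv. Qed.
#[local] Hint Extern 0 (measurable _) => solve [exact: measurable_Rplus] : core.

Lemma RplusE {R : realType} (x : R) : Rplus x = (0 < x).
Proof. by rewrite /Rplus /= in_itv /= andbT. Qed.

Lemma test_function_csupp {R : realType} (phi : R -> R) :
  test_function phi -> csupp phi.
Proof. by move=> /test_functionP[/smooth_continuous ? ?]; split. Qed.

Lemma test_function_derive1 {R : realType} (phi : R -> R) :
  test_function phi -> test_function (derive1 phi).
Proof.
move=> /test_functionP[sp [a [b [a0 ab ph]]]]; apply/test_functionP.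
split; first exact: smooth_derive1.
exists a, b; split => // x; apply: contraR => xab.
rewrite derive1E (@near_eq_derive _ _ _ phi (cst 0)) ?derive_cst//.
have z y : ~~ (a <= y <= b) -> phi y = 0.
  by move=> yab; apply/eqP; apply: contraNT yab => /ph.
have [xa|ax] := ltP x a.
  near=> y; apply: z; rewrite negb_and -ltNge; apply/orP; left.
  by near: y; exact: lt_nbhsl.
have bx : b < x by move: xab; rewrite ax /= -ltNge.
near=> y; apply: z; rewrite negb_and -!ltNge; apply/orP; right.
by near: y; exact: lt_nbhsr.
Unshelve. all: by end_near. Qed.

Lemma csupp_mul {R : realType} (f g : R -> R) :
  csupp f -> continuous g -> csupp (fun x => f x * g x).
Proof.
move=> [cf [a [b [a0 ab fab]]]] cg; split.
  by move=> x; apply: (@cvgM _ _ _ _ f g); [exact: cf|exact: cg].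
exists a, b; split => // x fg; apply: fab; apply: contraNneq fg => ->.
by rewrite mul0r.
Qed.

Lemma csupp_sqr {R : realType} (f : R -> R) : csupp f -> csupp (fun x => f x ^+ 2).
Proof.
by move=> cf; have [] := csupp_mul cf (proj1 cf).
Qed.

Lemma csupp_integrableT {R : realType} (f : R -> R) :
  csupp f -> leb.-integrable setT (EFin \o f).
Proof.
move=> [cf [a [b [a0 ab fab]]]].
have -> : EFin \o f = (EFin \o f) \_ `[a, b].
  apply/funext => x; rewrite patchE; case: ifPn => //= xab.
  congr EFin; apply/eqP; apply: contraNT xab => /fab xab.
  by apply/mem_set; rewrite /= in_itv.
have fi : leb.-integrable `[a, b] (EFin \o f).
  apply: continuous_compact_integrable; first exact: segment_compact.
  exact: continuous_subspaceT.
by have [/(_ fi)] := integrable_mkcond (mu := leb) (EFin \o f)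
  (measurable_itv `[a, b]).
Qed.

Lemma csupp_integrable {R : realType} (f : R -> R) (A : set R) : measurable A ->
  csupp f -> leb.-integrable A (EFin \o f).
Proof.
by move=> mA cf; apply: (@integrableS _ _ _ _ setT) => //; exact: csupp_integrableT.
Qed.

Lemma csupp_integralT {R : realType} (f : R -> R) : csupp f ->
  (\int[leb]_(x in Rplus) (f x)%:E = \int[leb]_x (f x)%:E)%E.
Proof.
move=> [cf [a [b [a0 ab fab]]]]; rewrite integral_mkcond; apply: eq_integral => x _.
rewrite patchE; case: ifPn => // xR; congr EFin; apply/esym/eqP.
apply: contraNT xR => /fab/andP[ax _]; apply/mem_set.
by rewrite /Rplus /= in_itv/= andbT (lt_le_trans a0).
Qed.

Definition dirichlet {R : realType} (phi : R -> R) : R :=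
  \int[leb]_(x in Rplus) (derive1 phi x ^+ 2).

Lemma test_sqr_csupp {R : realType} (phi : R -> R) : test_function phi ->
  csupp (fun x => derive1 phi x ^+ 2).
Proof. by move=> /test_function_derive1/test_function_csupp/csupp_sqr. Qed.

Lemma dirichlet_ge0 {R : realType} (phi : R -> R) : 0 <= dirichlet phi.
Proof. by apply: Rintegral_ge0 => x _; exact: sqr_ge0. Qed.

Lemma dirichletE {R : realType} (phi : R -> R) : test_function phi ->
  H10_normsq phi = (dirichlet phi)%:E.
Proof.
move=> tp; rewrite /dirichlet /Rintegral fineK//.
apply: integrable_fin_num => //.
exact: (csupp_integrable measurable_Rplus (test_sqr_csupp tp)).
Qed.

Lemma test_function_lincomb {R : realType} (r t : R) (f g : R -> R) :
  test_function f -> test_function g -> test_function (fun x => r * f x + t * g x).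
Proof.
move=> /test_functionP[sf [a [b [a0 ab fab]]]] /test_functionP[sg [c [d [c0 cd gcd]]]].
apply/test_functionP; split; first exact: smooth_lincomb.
exists (Num.min a c), (Num.max b d); split.
- by rewrite lt_min a0.
- by rewrite gt_min !lt_max ab.
move=> x /= fg; rewrite ge_min le_max.
have [fx0|/fab/andP[-> ->]//] := eqVneq (f x) 0.
have [gx0|/gcd/andP[-> ->]] := eqVneq (g x) 0; last by rewrite !orbT.
by move: fg; rewrite fx0 gx0 !mulr0 addr0 eqxx.
Qed.

Lemma test_functionB {R : realType} (f g : R -> R) :
  test_function f -> test_function g -> test_function (f \- g).
Proof.
have -> : f \- g = (fun x => 1 * f x + (- 1) * g x).
  by apply/funext => x /=; rewrite mul1r mulN1r.
exact: test_function_lincomb.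
Qed.

Lemma derive1B {R : realType} (f g : R -> R) : test_function f -> test_function g ->
  derive1 (f \- g) = fun x => derive1 f x - derive1 g x.
Proof.
move=> /test_functionP[sf _] /test_functionP[sg _].
have -> : f \- g = (fun x => 1 * f x + (- 1) * g x).
  by apply/funext => x /=; rewrite mul1r mulN1r.
rewrite derive1_lincomb; [|exact: smooth_derivable..].
by apply/funext => x; rewrite mul1r mulN1r.
Qed.

Lemma integrable_scale d (T : measurableType d) {R : realType} (mu : {measure set T -> \bar R})
    (A : set T) (r : R) (h : T -> R) : measurable A ->
  mu.-integrable A (EFin \o h) -> mu.-integrable A (EFin \o (fun x => r * h x)).
Proof.
move=> mA ih.
have -> : EFin \o (fun x => r * h x) = (fun x => r%:E * (EFin \o h) x)%E.
  by apply/funext => x /=; rewrite EFinM.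
exact: (integrableZl _ r ih).
Qed.

Lemma Rintegral_lincomb d (T : measurableType d) {R : realType}
    (mu : {measure set T -> \bar R}) (A : set T) (a b c : R) (f g h : T -> R) :
  mu.-integrable A (EFin \o f) -> mu.-integrable A (EFin \o g) ->
  mu.-integrable A (EFin \o h) -> measurable A ->
  \int[mu]_(x in A) (a * f x + b * g x + c * h x) =
  a * (\int[mu]_(x in A) f x) + b * (\int[mu]_(x in A) g x) + c * (\int[mu]_(x in A) h x).
Proof.
move=> If Ig Ih mA.
have IF := integrable_scale a mA If.
have IG := integrable_scale b mA Ig.
have IH := integrable_scale c mA Ih.
have IFG := integrableD mA IF IG.
rewrite (RintegralD mA IFG IH) (RintegralD mA IF IG).
by rewrite (RintegralZl _ mA If) (RintegralZl _ mA Ig) (RintegralZl _ mA Ih).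
Qed.

(** Pointwise identity for the derivatives, integrated. It turns almost minimality of two functions
    and their midpoint into smallness of their difference. *)
Lemma dirichlet_parallelogram {R : realType} (f g : R -> R) :
  test_function f -> test_function g ->
  dirichlet (fun x => 2^-1 * f x + 2^-1 * g x) =
  2^-1 * dirichlet f + 2^-1 * dirichlet g + (- 4^-1) * dirichlet (f \- g).
Proof.
move=> tf tg; rewrite /dirichlet.
have If := csupp_integrable measurable_Rplus (test_sqr_csupp tf).
have Ig := csupp_integrable measurable_Rplus (test_sqr_csupp tg).
have Ih := csupp_integrable measurable_Rplus
  (test_sqr_csupp (test_functionB tf tg)).
rewrite -(Rintegral_lincomb _ _ _ If Ig Ih)//.
apply: eq_Rintegral => x _.
rewrite derive1B// derive1_lincomb.
- by field.
- by apply: smooth_derivable; case/test_functionP: tf.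
- by apply: smooth_derivable; case/test_functionP: tg.
Qed.

Lemma integral_derive1 {R : realType} (phi : R -> R) (x y : R) : smooth phi -> x < y ->
  \int[leb]_(t in `[x, y]) derive1 phi t = phi y - phi x.
Proof.
move=> sp xy; rewrite /Rintegral (@continuous_FTC2 _ _ phi)//.
- by apply: continuous_subspaceT; apply: smooth_continuous; exact: smooth_derive1.
- split.
  + by move=> t _; exact: smooth_derivable.
  + by apply: cvg_at_right_filter; exact: smooth_continuous.
  + by apply: cvg_at_left_filter; exact: smooth_continuous.
Qed.

Lemma dirichlet_hoelder {R : realType} (phi : R -> R) (x y : R) : test_function phi ->
  (phi x - phi y) ^+ 2 <= `|x - y| * dirichlet phi.
Proof.
move=> tp; wlog xy : x y / x < y.
  move=> H; have [xy|yx|->] := ltgtP x y; [exact: H| |by rewrite !subrr normr0 mul0r expr0n].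
  by rewrite distrC -sqrrN opprB; exact: H.
have [sp _] := (test_functionP _).1 tp.
have tp' := test_function_csupp (test_function_derive1 tp).
(* Expand [0 <= \int_x^y (phi' - c)^2], with [c] the mean slope. *)
set s := phi y - phi x; set c := s / (y - x).
have yx0 : 0 < y - x by rewrite subr_gt0.
have I1 := csupp_integrable (measurable_itv `[x, y]) (test_sqr_csupp tp).
have I2 := csupp_integrable (measurable_itv `[x, y]) tp'.
have I3 : leb.-integrable `[x, y] (EFin \o (fun=> c ^+ 2)).
  by apply: continuous_compact_integrable;
    [exact: segment_compact|apply: continuous_subspaceT => ?; exact: cvg_cst].
have : 0 <= \int[leb]_(t in `[x, y]) (derive1 phi t - c) ^+ 2.
  by apply: Rintegral_ge0 => t _; exact: sqr_ge0.
have -> : (fun t => (derive1 phi t - c) ^+ 2) =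
    (fun t => 1 * derive1 phi t ^+ 2 + (- (2 * c)) * derive1 phi t + 1 * c ^+ 2).
  by apply/funext => t; ring.
rewrite (Rintegral_lincomb _ _ _ I1 I2 I3)//.
rewrite integral_derive1// -/s Rintegral_cst// !mul1r.
have muE : fine (leb `[x, y]) = y - x.
  by rewrite lebesgue_measure_itv /= lte_fin xy.
rewrite [in X in X -> _]muE => H.
(* The points may be negative. As [derive1 phi] vanishes off [Rplus], the Dirichlet integral is also
   the integral over the whole line, which contains the segment. *)
have le1 : \int[leb]_(t in `[x, y]) derive1 phi t ^+ 2 <= dirichlet phi.
  have -> : dirichlet phi = \int[leb]_t (derive1 phi t ^+ 2).
    by rewrite /dirichlet /Rintegral csupp_integralT//; exact: test_sqr_csupp.
  rewrite /Rintegral fine_le//.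
  - by apply: integrable_fin_num => //.
  - by apply: integrable_fin_num => //; exact: (csupp_integrableT (test_sqr_csupp tp)).
  apply: ge0_subset_integral => //=.
    by have /measurable_int := csupp_integrableT (test_sqr_csupp tp).
  by move=> t _; rewrite lee_fin sqr_ge0.
rewrite distrC gtr0_norm// -sqrrN opprB -/s.
have E : s ^+ 2 = (y - x) * (c * s) by rewrite /c; field; rewrite gt_eqF.
have E2 : c ^+ 2 * (y - x) = c * s by rewrite /c; field; rewrite gt_eqF.
rewrite E ler_pM2l//; apply: le_trans le1.
by move: H; rewrite E2; lra.
Qed.

(** * Fatou and completeness of L2 *)

Lemma measurable_fun_limn_einf d (T : measurableType d) (R : realType) (D : set T)
    (f : (T -> \bar R)^nat) : (forall n, measurable_fun D (f n)) ->
  measurable_fun D (fun x => limn_einf (f^~ x)).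
Proof.
move=> mf; apply: measurableT_comp => //.
by apply: (@measurable_fun_limn_esup _ _ _ _ (fun n x => - f n x)%E) => n;
  exact: measurableT_comp.
Qed.

Lemma fatou_ae d (T : measurableType d) (R : realType) (mu : {measure set T -> \bar R})
    (D : set T) (f : (T -> \bar R)^nat) (g : T -> \bar R) : measurable D ->
  (forall n, measurable_fun D (f n)) -> (forall n x, D x -> (0 <= f n x)%E) ->
  measurable_fun D g -> {ae mu, forall x, D x -> f n x @[n --> \oo] --> g x} ->
  (\int[mu]_(x in D) g x <= limn_einf (fun n => \int[mu]_(x in D) f n x))%E.
Proof.
move=> mD mf f0 mg fg.
rewrite (@ae_eq_integral _ _ _ _ _ (fun x => limn_einf (f ^~ x)))//.
- exact: fatou.
- exact: measurable_fun_limn_einf.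
- move: fg; apply: filterS => x fg Dx.
  by have [->] := cvg_limn_einf_sup (fg Dx).
Qed.

Lemma limn_einf_le_near (R : realType) (u : (\bar R)^nat) (c : \bar R) :
  (\forall n \near \oo, (u n <= c)%E) -> (limn_einf u <= c)%E.
Proof.
move=> uc; rewrite limn_einf_lim; apply: lime_le; first exact: is_cvg_einfs.
move: uc; apply: filterS => n; apply: le_trans.
by apply: ereal_inf_lbound; exists n => /=.
Qed.

Lemma limn_einf_gt_near (R : realType) (u : (\bar R)^nat) (c : \bar R) :
  (c < limn_einf u)%E -> \forall n \near \oo, (c < u n)%E.
Proof.
rewrite limn_einf_lim => cu.
have [N cN] : exists N, (c < einfs u N)%E.
  apply: contrapT => /forallNP H; move: cu; apply/negP; rewrite -leNgt.
  apply: lime_le; first exact: is_cvg_einfs.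
  by apply: nearW => n; rewrite leNgt; apply/negP; exact: H.
exists N => // n /= Nn; apply: (lt_le_trans cN).
by apply: ereal_inf_lbound; exists n.
Qed.

Lemma L2_complete d (T : measurableType d) (R : realType) (mu : {measure set T -> \bar R})
    (D : set T) (f : nat -> T -> R) : measurable D ->
  (forall n, measurable_fun D (f n)) ->
  (forall e : R, 0 < e -> exists N : nat, forall m n : nat, (N <= m)%N -> (N <= n)%N ->
    (\int[mu]_(x in D) ((f m x - f n x) ^+ 2)%:E <= e%:E)%E) ->
  exists g : T -> R, measurable_fun D g /\
    forall e : R, 0 < e -> exists N : nat, forall n : nat, (N <= n)%N ->
      (\int[mu]_(x in D) ((f n x - g x) ^+ 2)%:E <= e%:E)%E.
Proof.
move=> mD mf fC.
have mf2 m n : measurable_fun D (fun x => ((f m x - f n x) ^+ 2)%:E).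
  by apply/measurable_EFinP; apply: measurable_funX; exact: measurable_funB.
(* After multiplication by [4 ^+ k] these bounds become [1 / 2 ^ k.+1], whose sum is at most 1. *)
pose eps k : R := (1 / (2 ^ k.+1)%:R) / 4 ^+ k.
have eps0 k : 0 < eps k by rewrite /eps !divr_gt0// ?ltr0n ?expn_gt0// exprn_gt0.
(* Along the fast subsequence [f (s k)], [\sum_k 4^k (f (s k.+1) - f (s k))^2] is integrable,
   so almost everywhere the increments are [O(2^-k)]. *)
have /choice[N NP] : forall k, exists N : nat, forall m n, (N <= m)%N -> (N <= n)%N ->
    (\int[mu]_(x in D) ((f m x - f n x) ^+ 2)%:E <= (eps k)%:E)%E.
  by move=> k; exact: fC.
(* The sum puts [s k] above every [N j] with [j <= k]; the added [k] makes [s k] tend to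
   infinity. *)
pose s k := (\sum_(i < k.+1) N i + k)%N.
have sN j k : (j <= k)%N -> (N j <= s k)%N.
  move=> jk; rewrite /s (bigD1 (Ordinal (_ : j < k.+1)%N))//=.
  by rewrite -addnA leq_addr.
pose u x k := f (s k) x.
pose S x := (\sum_(0 <= k <oo) (4 ^+ k * (u x k.+1 - u x k) ^+ 2)%:E)%E.
have mterm k : measurable_fun D (fun x => (4 ^+ k * (u x k.+1 - u x k) ^+ 2)%:E).
  apply/measurable_EFinP; apply: measurable_funM => //.
  exact: (measurable_funX _ (measurable_funB (mf (s k.+1)) (mf (s k)))).
have term0 k x : (0 <= (4 ^+ k * (u x k.+1 - u x k) ^+ 2)%:E)%E.
  by rewrite lee_fin mulr_ge0 ?sqr_ge0 ?exprn_ge0.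
have mS : measurable_fun D S by apply: ge0_emeasurable_sum => // *.
have S0 x : (0 <= S x)%E by apply: nneseries_ge0.
have iS : mu.-integrable D S.
  apply/integrableP; split => //.
  under eq_integral do rewrite gee0_abs//.
  rewrite integral_nneseries//.
  apply: (@le_lt_trans _ _ 1%:E); last exact: ltry.
  apply: le_trans (epsilon_trick0 xpredT ler01).
  apply: lee_nneseries => [k _ _|k _]; first by apply: integral_ge0 => *.
  under eq_integral do rewrite EFinM.
  rewrite ge0_integralZl//; last 2 first.
  - exact: mf2.
  - by move=> x _; rewrite lee_fin sqr_ge0.
  have := NP k (s k.+1) (s k) (sN _ _ (leqnSn k)) (sN _ _ (leqnn k)).
  rewrite /eps -lee_pdivlMl ?exprn_gt0// -EFinM.
  by rewrite [_^-1 * _]mulrC.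
have cvgu x : S x \is a fin_num -> cvgn (u x).
  move=> Sx; set r := fine (S x).
  have r0 : 0 <= r by rewrite fine_ge0.
  have b k : `|u x k.+1 - u x k| <= Num.sqrt r * 2^-1 ^+ k.
    have : ((4 ^+ k * (u x k.+1 - u x k) ^+ 2)%:E <= r%:E)%E.
      rewrite /r fineK//.
      apply: le_trans (@nneseries_lim_ge _ _ xpredT 0 k.+1 _) => //.
      rewrite big_mkord big_ord_recr /= leeDr//.
      by apply: sume_ge0.
    rewrite lee_fin => h.
    rewrite -ler_sqr ?nnegrE ?mulr_ge0 ?sqrtr_ge0 ?exprn_ge0//.
    rewrite exprMn sqr_sqrtr// -exprM mulnC exprM real_normK ?num_real//.
    have -> : 2^-1 ^+ 2 = 4^-1 :> R by field.
    by rewrite exprVn ler_pdivlMr ?exprn_gt0// mulrC.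
  suff : cvgn (series (telescope (u x))).
    rewrite telescopeK => /cvg_ex[l /= ul].
    move: (u x 0%N) ul => c ul; apply/cvg_ex; exists (l + c).
    have -> : u x = (fun n => (u x n - c) + c).
      by apply/funext => n; rewrite subrK.
    by apply: cvgD => //; exact: cvg_cst.
  apply: normed_cvg.
  apply: (@series_le_cvg _ _ (geometric (Num.sqrt r) 2^-1)) => //.
  - by move=> n /=; exact: normr_ge0.
  - by move=> n /=; rewrite mulr_ge0 ?sqrtr_ge0 ?exprn_ge0.
  - by apply: is_cvg_geometric_series; rewrite ger0_norm// invf_lt1// ltr1n.
(* An upper limit is measurable without any convergence. Where [u x] converges, [g x] is its limit;
   on the remaining null set its value is irrelevant. *)
pose g x := fine (limn_esup (fun k => (u x k)%:E)).
have mg : measurable_fun D g.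
  apply: (measurableT_comp (fine_measurable measurableT)).
  apply: (@measurable_fun_limn_esup _ _ _ _ (fun k x => (u x k)%:E)) => k.
  by apply/measurable_EFinP; exact: mf.
have ug x : cvgn (u x) -> u x k @[k --> \oo] --> g x.
  move=> /cvg_ex[l ul]; have : (u x k)%:E @[k --> \oo] --> l%:E.
    by apply: cvg_EFin; [exact: nearW|exact: ul].
  by move=> /cvg_limn_einf_sup[_]; rewrite /g => ->.
exists g; split => // e e0.
have [M MP] := fC e e0; exists M => n Mn.
(* With [n] fixed, Fatou along the subsequence turns the Cauchy bound into a bound on the distance
   to [g]. *)
apply: (@le_trans _ _ (limn_einf (fun k => \int[mu]_(x in D) ((f n x - f (s k) x) ^+ 2)%:E)%E)).
  apply: fatou_ae => //.
  - by move=> k x Dx; rewrite lee_fin sqr_ge0.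
  - by apply/measurable_EFinP; apply: measurable_funX; exact: measurable_funB.
  have := integrable_ae mD iS; apply: filterS => x Sx Dx.
  apply: cvg_EFin; first exact: nearW.
  have h := ug x (cvgu x (Sx Dx)).
  apply: (@cvg_comp _ _ _ (fun k => f n x - u x k) (fun y : R => y ^+ 2)
     _ (nbhs (f n x - g x))).
    by apply: cvgB => //; exact: cvg_cst.
  exact: exprn_continuous.
apply: limn_einf_le_near; exists M => // k /= Mk.
by apply: MP => //; rewrite (leq_trans Mk)// /s leq_addl.
Qed.

(** * The fundamental lemma of the calculus of variations *)

Lemma csupp_bounded {R : realType} (f : R -> R) : csupp f ->
  exists M : R, 0 <= M /\ forall x, `|f x| <= M.
Proof.
move=> [cf [a [b [a0 ab fab]]]].
have [c _ cmax] : exists2 c, c \in `[a, b] & forall t, t \in `[a, b] -> `|f t| <= `|f c|.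
  apply: (@EVT_max R (fun t => `|f t|)); first exact: ltW.
  apply: continuous_subspaceT => x.
  by apply: cvg_norm; exact: cf.
exists `|f c|; split => // x.
have [->|/fab xab] := eqVneq (f x) 0; first by rewrite normr0.
by apply: cmax; rewrite in_itv.
Qed.

Lemma integrable_bounded_support {R : realType} (a b M : R) (h f : R -> R) :
  measurable_fun setT f -> (forall x, f x != 0 -> a <= x <= b) ->
  (forall x, `|f x| <= M) ->
  leb.-integrable `[a, b] (EFin \o h) -> leb.-integrable setT (fun x => (h x * f x)%:E).
Proof.
move=> mf fab fM ih.
have M0 : 0 <= M by apply: le_trans (fM 0).
have -> : (fun x => (h x * f x)%:E) = (fun x => (h x * f x)%:E) \_ `[a, b].
  apply/funext => x; rewrite patchE; case: ifPn => // xab.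
  have -> : f x = 0.
    apply/eqP; apply: contraNT xab => /fab xab.
    by apply/mem_set; rewrite /= in_itv.
  by rewrite mulr0.
have i1 : leb.-integrable `[a, b] (fun x => (h x * f x)%:E).
  have iM : leb.-integrable `[a, b] (EFin \o (fun x => M * h x)) by exact: integrable_scale.
  apply: (le_integrable _ _ _ iM) => //.
  - apply/measurable_EFinP; apply: measurable_funM; last exact: measurable_funTS.
    by case/integrableP: ih => /measurable_EFinP.
  - by move=> x _ /=; rewrite lee_fin !normrM (ger0_norm M0) mulrC ler_wpM2r ?fM.
by have [/(_ i1)] := integrable_mkcond (mu := leb) (fun x => (h x * f x)%:E)
  (measurable_itv `[a, b]).
Qed.

Lemma locally_integrable_itv {R : realType} (h : R -> R) (a b : R) :
  locally_integrable Rplus h -> 0 < a -> leb.-integrable `[a, b] (EFin \o h).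
Proof.
move=> [mh _ ih] a0.
have ab : `[a, b] `<=` (Rplus : set R).
  by move=> x; rewrite /Rplus /= !in_itv /= => /andP[ax _]; rewrite andbT (lt_le_trans a0).
apply/integrableP; split.
  by apply/measurable_EFinP; apply: measurable_funS mh.
by apply: ih => //; exact: segment_compact.
Qed.

Lemma locally_integrable_csupp {R : realType} (h f : R -> R) :
  locally_integrable Rplus h -> csupp f ->
  leb.-integrable Rplus (fun x => (h x * f x)%:E).
Proof.
move=> lh cf; apply: (@integrableS _ _ _ _ setT) => //.
have [M [_ fM]] := csupp_bounded cf.
case: cf => cf [a [b [a0 ab fab]]].
apply: (integrable_bounded_support _ fab fM); first exact: continuous_measurable_fun.
exact: locally_integrable_itv.
Qed.

Section cutoff.
Context {R : realType} (beta : R) (eta : R -> R).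
Hypotheses (beta0 : 0 < beta) (heta : cutoff beta eta).

(** Off [[0, 1]] the cutoff is locally constant; on it, [derive1 eta] is continuous and attains its
    maximum. *)
Lemma cutoff_derive1_bounded : exists L : R, 0 <= L /\
  forall x, `|derive1 eta x| <= L * \1_(`[0%R, 1%R]%classic) x.
Proof.
have [se e01 e0 e1 _] := heta.
have [c _ cmax] : exists2 c, c \in `[0, 1] &
    forall t, t \in `[0, 1] -> `|derive1 eta t| <= `|derive1 eta c|.
  apply: (@EVT_max R (fun t => `|derive1 eta t|)); first exact: ler01.
  apply: continuous_subspaceT => x; apply: cvg_norm.
  exact: (smooth_continuous (smooth_derive1 se)).
exists (`|derive1 eta c|); split => // x; rewrite indicE.
have [x01|x01] := boolP (x \in `[0%R, 1%R]%classic).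
  by rewrite mulr1; apply: cmax; move: x01; rewrite inE.
rewrite mulr0 normr_le0; apply/eqP.
have {}x01 : ~~ (0 <= x <= 1) by apply: contra x01 => x01; rewrite inE /= in_itv.
have [x0|x0] := ltP x 0.
  rewrite derive1E (@near_eq_derive _ _ _ eta (cst beta)) ?derive_cst//.
  near=> y; apply: e0; apply: ltW; near: y; exact: lt_nbhsl.
have x1 : 1 < x by move: x01; rewrite x0 /= -ltNge.
rewrite derive1E (@near_eq_derive _ _ _ eta (cst 0)) ?derive_cst//.
near=> y; apply: e1; apply: ltW; near: y; exact: lt_nbhsr.
Unshelve. all: by end_near. Qed.

(** To the left of [a] and [b] both terms equal [beta], and far to the right both vanish; positivity
    of [a] and [b] keeps the support away from 0. *)
Lemma test_function_bump (a b s t : R) : 0 < a -> 0 < b -> 0 < s -> 0 < t ->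
  test_function (fun x => eta ((x - b) / t) - eta ((x - a) / s)).
Proof.
move=> a0 b0 s0 t0; have [se e01 e0 e1 _] := heta.
apply/test_functionP; split.
  by apply: (@smoothB _ (fun x => eta ((x - b) / t)) (fun x => eta ((x - a) / s)));
    apply: smooth_affine.
exists (Num.min a b), (Num.max (a + s) (b + t)); split.
- by rewrite lt_min a0.
- by rewrite gt_min !lt_max ltrDl s0.
move=> x; apply: contraR; rewrite negb_and -!ltNge lt_min gt_max.
move=> /orP[/andP[xa xb]|/andP[ax bx]].
- by rewrite !e0 ?subrr// pmulr_lle0 ?invr_gt0// subr_le0 ltW.
- by rewrite !e1 ?subrr// ler_pdivlMr// mul1r; lra.
Qed.

(** The transition of a translate starts at its base point [c] and ends at [c + 1 / n.+1]: the value
    is [beta] for [x <= c] and eventually 0 for [x > c]. This is why the limit interval is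
    half-open. *)
Lemma bump_cvg (a b x : R) : a < b ->
  eta ((x - b) / n.+1%:R^-1) - eta ((x - a) / n.+1%:R^-1) @[n --> \oo] -->
  beta * \1_(`]a, b]%classic) x.
Proof.
move=> ab; have [se e01 e0 e1 _] := heta.
have ev (c : R) : c < x -> \forall n \near \oo, eta ((x - c) / n.+1%:R^-1) = 0.
  move=> cx; have xc : 0 < x - c by rewrite subr_gt0.
  have := near_infty_natSinv_lt (PosNum xc); apply: filterS => n /= /ltW h.
  by rewrite e1// ler_pdivlMr ?invr_gt0 ?ltr0n// mul1r.
have ne (c : R) n : x <= c -> eta ((x - c) / n.+1%:R^-1) = beta.
  by move=> xc; rewrite e0// pmulr_lle0 ?subr_le0// invrK ltr0n.
rewrite indicE; have [xa|ax] := leP x a.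
  rewrite memNset ?mulr0; last by rewrite /= in_itv /= ltNge xa.
  have xb := ltW (le_lt_trans xa ab).
  by under eq_fun do rewrite !ne// subrr; exact: cvg_cst.
have [xb|bx] := leP x b.
  rewrite mem_set ?mulr1; last by rewrite /= in_itv /= ax.
  apply: cvg_near_cst; move: (ev a ax); apply: filterS => n ->.
  by rewrite ne// subr0.
rewrite memNset ?mulr0; last by rewrite /= in_itv /= ax leNgt bx.
apply: cvg_near_cst; near=> n.
have -> : eta ((x - a) / n.+1%:R^-1) = 0 by near: n; exact: ev.
have -> : eta ((x - b) / n.+1%:R^-1) = 0 by near: n; exact: ev.
by rewrite subrr.
Unshelve. all: by end_near. Qed.

(** Steep bumps converge to [beta] times the indicator of []a, b]], and dominated convergence
    carries the vanishing integrals to the limit. *)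
Lemma integral_itv_eq0 (h : R -> R) (a b : R) : locally_integrable Rplus h ->
  (forall phi, test_function phi -> (\int[leb]_(x in Rplus) (h x * phi x)%:E = 0)%E) ->
  0 < a -> a < b -> (\int[leb]_(x in `]a, b]) (h x)%:E = 0)%E.
Proof.
move=> lh h0 a0 ab; have [se e01 e0 e1 _] := heta.
pose T n x := eta ((x - b) / n.+1%:R^-1) - eta ((x - a) / n.+1%:R^-1).
have tT n : test_function (T n).
  by apply: test_function_bump; rewrite ?invr_gt0 ?ltr0n// (lt_trans a0).
(* Transitions have width at most 1, so a single segment contains the supports of all [T n] and one
   dominating function serves. *)
have sT n x : T n x != 0 -> a <= x <= b + 1.
  apply: contraR; rewrite negb_and -!ltNge => /orP[xa|bx]; rewrite /T.
    rewrite !e0 ?subrr// pmulr_lle0 ?invrK ?ltr0n// subr_le0 ltW//.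
    exact: lt_trans ab.
  have le1 (c : R) : c <= b -> 1 <= (x - c) / n.+1%:R^-1.
    move=> cb; rewrite ler_pdivlMr ?invr_gt0 ?ltr0n// mul1r.
    rewrite (@le_trans _ _ 1)//; last by lra.
    by rewrite invf_le1 ?ler1n ?ltr0n.
  by rewrite !e1 ?subrr// le1// ltW.
have bT n x : `|T n x| <= beta.
  rewrite /T; have /andP[] := e01 ((x - b) / n.+1%:R^-1).
  have /andP[] := e01 ((x - a) / n.+1%:R^-1).
  by move=> *; rewrite ler_norml; apply/andP; split; lra.
have ih : leb.-integrable `[a, b + 1] (EFin \o h) by exact: locally_integrable_itv.
have mh : measurable_fun Rplus h by case: lh.
have s1 x : (beta * \1_(`[a, b + 1]%classic) x : R) != 0 -> a <= x <= b + 1.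
  rewrite indicE; case: (boolP (x \in _)); last by rewrite mulr0 eqxx.
  by move=> /set_mem; rewrite /= in_itv.
have b1 x : `|beta * \1_(`[a, b + 1]%classic) x| <= beta.
  rewrite indicE normrM (gtr0_norm beta0).
  by case: (x \in _); rewrite ?normr1 ?mulr1// normr0 mulr0 ltW.
have ig : leb.-integrable `[a, b + 1] (EFin \o (fun x => `|h x|)).
  exact: (integrable_abse ih).
have mind (c d : R) : measurable_fun setT (fun x : R => beta * \1_(`[c, d]%classic) x).
  by apply: measurable_funM.
have dom : leb.-integrable Rplus (fun x => (`|h x| * (beta * \1_(`[a, b + 1]%classic) x))%:E).
  apply: (@integrableS _ _ _ _ setT) => //.
  exact: (integrable_bounded_support (mind a (b + 1)) s1 b1 ig).
have mab : measurable_fun Rplus (fun x : R => beta * \1_(`]a, b]%classic) x).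
  by apply: measurable_funM.
have [||||_ _ lim] := @dominated_convergence _ _ _ leb Rplus measurable_Rplus
  (fun n x => (h x * T n x)%:E)
  (fun x => (h x * (beta * \1_(`]a, b]%classic) x))%:E) _ _ _ _ dom.
- move=> n; apply/measurable_EFinP; apply: measurable_funM => //.
  apply: measurable_funTS; apply: continuous_measurable_fun.
  exact: (proj1 (test_function_csupp (tT n))).
- by apply/measurable_EFinP; apply: measurable_funM.
- apply: aeW => x _; apply: cvg_EFin; first exact: nearW.
  by apply: (@cvgM _ _ _ _ (cst (h x)) (fun n => T n x)); [exact: cvg_cst|exact: bump_cvg].
- apply: aeW => x n _; rewrite lee_fin normrM ler_wpM2l// indicE.
  have [|xab] := boolP (x \in _); first by rewrite mulr1 bT.
  have [->|/sT xab'] := eqVneq (T n x) 0; first by rewrite normr0 mulr0.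
  by move: xab; rewrite mem_set//= in_itv.
have E : (\int[leb]_(x in Rplus) (h x * (beta * \1_(`]a, b]%classic) x))%:E = 0)%E.
  apply: (cvg_unique _ lim) => //=.
  by under eq_fun do rewrite h0//; exact: cvg_cst.
have : (beta%:E * \int[leb]_(x in `]a, b]) (h x)%:E = 0)%E.
  rewrite -integralZl//; last first.
    by apply: (integrableS _ _ _ ih) => // x; rewrite /= !in_itv /=; lra.
  rewrite -E integral_mkcond [RHS]integral_mkcond; apply: eq_integral => x _.
  rewrite !patchE indicE; have [xab|xab] := boolP (x \in `]a, b]%classic).
    rewrite mem_set ?mulr1 ?(mulrC (h x))//; move: xab => /set_mem /=.
    rewrite /Rplus /= !in_itv /= => /andP[ax _]; rewrite andbT; exact: lt_trans ax.
  by rewrite !mulr0; case: ifP.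
by move/eqP; rewrite mule_eq0 eqe gt_eqF//= => /eqP.
Qed.

(** The primitive of [h] started at [c n] is identically 0, so Lebesgue differentiation gives
    [h = 0] almost everywhere on []c n, d n]]; these intervals exhaust [Rplus]. The truncation
    [hn n] makes the primitive available on the whole line. *)
Lemma locally_integrable_ae0 (h : R -> R) : locally_integrable Rplus h ->
  (forall phi, test_function phi -> (\int[leb]_(x in Rplus) (h x * phi x)%:E = 0)%E) ->
  {ae leb, forall x, Rplus x -> h x = 0}.
Proof.
move=> lh h0.
pose c n : R := n.+1%:R^-1; pose d n : R := n.+1%:R.
have c0 n : 0 < c n by rewrite invr_gt0 ltr0n.
pose hn n := h \_ (`]c n, d n]%classic).
have ihn n : leb.-integrable `]c n, d n] (EFin \o h).
  have ih := locally_integrable_itv (d n) lh (c0 n).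
  apply: (integrableS _ _ _ ih) => //; exact: subset_itv_oc_cc.
have H n : {ae leb, forall x, `]c n, d n]%classic x -> h x = 0}.
  have ihT : leb.-integrable setT (EFin \o hn n).
    rewrite /hn -restrict_EFin.
    by have [/(_ (ihn n))] := integrable_mkcond (mu := leb) (EFin \o h)
      (measurable_itv `]c n, d n]).
  have F0 y : \int[leb]_(t in [set` Interval (BRight (c n)) (BRight y)]) hn n t = 0.
    rewrite /Rintegral.
    have -> : (\int[leb]_(t in `]c n, y]) (hn n t)%:E =
        \int[leb]_(t in `]c n, Num.min y (d n)]) (h t)%:E)%E.
      rewrite integral_mkcond [RHS]integral_mkcond; apply: eq_integral => x _.
      rewrite !patchE /hn !patchE !mem_setE !in_itv /= le_min.
      by case: (c n < x) => //=; case: (x <= y) => //=; case: (x <= d n).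
    have [le|lt] := leP (Num.min y (d n)) (c n).
      by rewrite set_itv_ge ?integral_set0// bnd_simp -leNgt.
    by rewrite integral_itv_eq0.
  have := @FTC1 R (hn n) (BRight (c n)).
  have i1 y : leb.-integrable [set` Interval (BRight (c n)) (BRight y)] (EFin \o hn n).
    by apply: (integrableS _ _ _ ihT).
  have i2 : locally_integrable setT (hn n).
    exact: (integrable_locally _ (ihn n)).
  move=> /(_ i1 i2); apply: filterS; first exact: (ae_filter_ringOfSetsType leb).
  move=> x /=.
  have -> : (fun x0 => \int[leb]_(t in `]c n, x0]) hn n t) = cst 0.
    by apply/funext => y; exact: F0.
  move=> K xcd; have [|_] := K; first by move: xcd; rewrite /= in_itv /= => /andP[].
  by rewrite derive1_cst /hn patchE mem_set// => <-.
have := ae_foralln H; apply: filterS.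
move=> x Hx x0.
have {}x0 : 0 < x by move: x0; rewrite /Rplus /= in_itv /= andbT.
have [n1 _ P1] := near_infty_natSinv_lt (PosNum x0).
pose n2 := Num.truncn x.
apply: (Hx (maxn n1 n2)); rewrite /= in_itv /=; apply/andP; split.
  exact: (P1 _ (leq_maxl _ _)).
apply/ltW/(lt_le_trans (truncnS_gt x)).
by rewrite ler_nat ltnS leq_maxr.
Qed.

End cutoff.

(** * Weak derivatives of limits of test functions *)

Lemma csupp_integral_itv {R : realType} (f : R -> R) (a b : R) : 0 < a ->
  (forall x, f x != 0 -> a <= x <= b) ->
  \int[leb]_(x in Rplus) f x = \int[leb]_(x in `[a, b]) f x.
Proof.
move=> a0 fab; rewrite /Rintegral; congr fine.
rewrite integral_mkcond [RHS]integral_mkcond; apply: eq_integral => x _.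
have [fx|/fab xab] := eqVneq (f x) 0.
  by rewrite !patchE fx; do 2 case: ifP.
rewrite !patchE !mem_set//= ?in_itv//=.
by rewrite RplusE; case/andP: xab => ax _; rewrite (lt_le_trans a0).
Qed.

(** The boundary terms vanish through [psi] alone. Since [phi] is merely smooth, the constant 1 is
    allowed, which yields [integral_derive1_test]. *)
Lemma integral_by_parts_test {R : realType} (phi psi : R -> R) :
  smooth phi -> test_function psi ->
  \int[leb]_(x in Rplus) (phi x * derive1 psi x) =
  - \int[leb]_(x in Rplus) (derive1 phi x * psi x).
Proof.
move=> sphi tpsi; have [spsi [a [b [a0 ab pab]]]] := (test_functionP _).1 tpsi.
have [_ [c [d [c0 cd pcd]]]] := (test_functionP _).1 (test_function_derive1 tpsi).
(* Both ends lie strictly outside the supports of [psi] and of its derivative. *)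
pose l := Num.min a c / 2; pose r := Num.max b d + 1.
have [ma mc] : Num.min a c <= a /\ Num.min a c <= c by rewrite !ge_min !lexx orbT.
have [mb md] : b <= Num.max b d /\ d <= Num.max b d by rewrite !le_max !lexx orbT.
have m0 : 0 < Num.min a c by rewrite lt_min a0.
have l0 : 0 < l by rewrite divr_gt0.
have la : l < a by rewrite /l; lra.
have lc : l < c by rewrite /l; lra.
have br : b < r by rewrite /r; lra.
have dr : d < r by rewrite /r; lra.
have lr : l < r by lra.
rewrite (@csupp_integral_itv _ _ l r) //; last first.
  move=> x; rewrite mulf_eq0 negb_or => /andP[_ /pcd/andP[h1 h2]].
  by apply/andP; split; lra.
rewrite (@csupp_integral_itv _ (fun x => derive1 phi x * psi x) l r) //; last first.
  move=> x; rewrite mulf_eq0 negb_or => /andP[_ /pab/andP[h1 h2]].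
  by apply/andP; split; lra.
have psi0 x : ~~ (a <= x <= b) -> psi x = 0.
  by move=> xab; apply/eqP; apply: contraNT xab => /pab.
have oo (f : R -> R) : smooth f -> derivable_oo_LRcontinuous f l r.
  move=> sf; split.
  + by move=> t _; exact: smooth_derivable.
  + by apply: cvg_at_right_filter; exact: smooth_continuous.
  + by apply: cvg_at_left_filter; exact: smooth_continuous.
rewrite (@Rintegration_by_parts _ phi psi (derive1 phi) (derive1 psi))//.
- rewrite !psi0; first by rewrite !mulr0 subrr sub0r.
    by rewrite negb_and -!ltNge la.
  by rewrite negb_and -!ltNge br orbT.
- by apply: continuous_subspaceT; exact/smooth_continuous/smooth_derive1.
- exact: oo.
- by apply: continuous_subspaceT; exact/smooth_continuous/smooth_derive1.
- exact: oo.
Qed.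

Lemma integral_derive1_test {R : realType} (psi : R -> R) : test_function psi ->
  \int[leb]_(x in Rplus) derive1 psi x = 0.
Proof.
move=> tpsi.
have s1 : smooth (cst 1 : R -> R).
  have E n : derive1n n.+1 (cst (1 : R)) = cst (0 : R).
    elim: n => [|n IH]; first by rewrite derive1nS; apply/funext => x; exact: derive1_cst.
    by rewrite derive1nS IH; apply/funext => x; exact: derive1_cst.
  by case=> [|n] x; [exact: derivable_cst|rewrite E; exact: derivable_cst].
have := integral_by_parts_test s1 tpsi.
under eq_Rintegral do rewrite mul1r.
move=> ->; under eq_Rintegral do rewrite derive1_cst mul0r.
by rewrite Rintegral_cst// mul0r oppr0.
Qed.

(** Triangle inequality for the squared norm: with [p = f - g], the pointwise defect is
    [t^-1 * (t * g - p) ^+ 2]. A small [t] brings the factor of the main term close to 1, and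
    [t = 1] is enough for finiteness. *)
Lemma sqr_integral_le d (T : measurableType d) (R : realType)
    (mu : {measure set T -> \bar R}) (D : set T) (f g : T -> R) (t : R) :
  measurable D -> measurable_fun D f -> measurable_fun D g -> 0 < t ->
  (\int[mu]_(x in D) (f x ^+ 2)%:E <= (1 + t)%:E * \int[mu]_(x in D) (g x ^+ 2)%:E
    + (1 + t^-1)%:E * \int[mu]_(x in D) ((f x - g x) ^+ 2)%:E)%E.
Proof.
move=> mD mf mg t0.
have mg2 : measurable_fun D (fun x => (g x ^+ 2)%:E).
  by apply/measurable_EFinP; exact: measurable_funX.
have mfg2 : measurable_fun D (fun x => ((f x - g x) ^+ 2)%:E).
  by apply/measurable_EFinP; apply: measurable_funX; exact: measurable_funB.
have t1 : 0 <= 1 + t by lra.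
have t2 : 0 <= 1 + t^-1 by rewrite addr_ge0// invr_ge0 ltW.
rewrite -ge0_integralZl//; [|by move=> x _; rewrite lee_fin sqr_ge0].
rewrite -ge0_integralZl//; [|by move=> x _; rewrite lee_fin sqr_ge0].
rewrite -ge0_integralD//; last 4 first.
- by move=> x _; rewrite -EFinM lee_fin mulr_ge0// sqr_ge0.
- exact: measurable_funeM.
- by move=> x _; rewrite -EFinM lee_fin mulr_ge0// sqr_ge0.
- exact: measurable_funeM.
apply: ge0_le_integral => //.
- by move=> x _; rewrite lee_fin sqr_ge0.
- by apply/measurable_EFinP; exact: measurable_funX.
- by apply: emeasurable_funD; exact: measurable_funeM.
move=> x _; rewrite -!EFinM -EFinD lee_fin.
set p := f x - g x; have -> : f x = g x + p by rewrite /p; ring.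
rewrite -subr_ge0.
have -> : (1 + t) * g x ^+ 2 + (1 + t^-1) * p ^+ 2 - (g x + p) ^+ 2 =
  t^-1 * (t * g x - p) ^+ 2 by field; rewrite gt_eqF.
by rewrite mulr_ge0 ?sqr_ge0// invr_ge0 ltW.
Qed.

(** The body of [H10] with its sequence exposed, because later arguments follow a particular
    approximating sequence. *)
Definition h10_seq {R : realType} (phi : nat -> R -> R) (u : R -> R) : Prop :=
  [/\ forall n, test_function (phi n), H10_cauchy phi &
      forall x : R, 0 <= x -> phi n x @[n --> \oo] --> u x].

Lemma H10_cauchyP {R : realType} (phi : nat -> R -> R) :
  (forall n, test_function (phi n)) ->
  H10_cauchy phi <-> forall e : R, 0 < e -> exists N : nat, forall m n : nat,
    (N <= m)%N -> (N <= n)%N -> dirichlet (phi m \- phi n) < e.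
Proof.
move=> tp; split=> H e e0.
  have se0 : 0 < Num.sqrt e by rewrite sqrtr_gt0.
  have [N NP] := H (Num.sqrt e) se0.
  exists N => m n Nm Nn; have := NP m n Nm Nn.
  by rewrite dirichletE ?lte_fin ?sqr_sqrtr// ?ltW//; exact: test_functionB.
have [N NP] := H (e ^+ 2) (exprn_gt0 _ e0); exists N => m n Nm Nn.
by rewrite dirichletE ?lte_fin; [exact: NP|exact: test_functionB].
Qed.

Lemma test_function0 {R : realType} (phi : R -> R) : test_function phi -> phi 0 = 0.
Proof.
move=> /test_functionP[_ [a [b [a0 ab pab]]]]; apply/eqP; apply: contraTT isT => /pab.
by rewrite leNgt a0.
Qed.

Lemma test_hoelder0 {R : realType} (phi : R -> R) (x : R) : test_function phi -> 0 <= x ->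
  phi x ^+ 2 <= x * dirichlet phi.
Proof.
move=> tp x0; have := dirichlet_hoelder x 0 tp.
by rewrite test_function0// !subr0 ger0_norm.
Qed.

(** The difference [phi n \- phi m] vanishes at 0, so its square at [x] is at most [x] times its
    Dirichlet integral; then [m] tends to infinity. *)
Lemma h10_seq_close {R : realType} (phi : nat -> R -> R) (u : R -> R) :
  h10_seq phi u -> forall e : R, 0 < e -> exists N : nat, forall n, (N <= n)%N ->
  forall x, 0 <= x -> (phi n x - u x) ^+ 2 <= x * e.
Proof.
move=> [tp /(H10_cauchyP tp) cp pu] e e0.
have [N NP] := cp e e0; exists N => n Nn x x0.
have : (phi n x - phi m x) ^+ 2 @[m --> \oo] --> (phi n x - u x) ^+ 2.
  apply: (@cvg_comp _ _ _ (fun m => phi n x - phi m x) (fun y : R => y ^+ 2)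
     _ (nbhs (phi n x - u x))).
    by apply: cvgB; [exact: cvg_cst|exact: pu].
  exact: exprn_continuous.
move=> /cvgr_to_le; apply; exists N => // m Nm.
have := test_hoelder0 (test_functionB (tp n) (tp m)) x0.
by move=> /le_trans; apply; rewrite ler_wpM2l// ltW// NP.
Qed.

(** A compact set has finite measure, and [g] is bounded in absolute value by [1 + g ^+ 2]. *)
Lemma sqr_integrable_locally {R : realType} (g : R -> R) : measurable_fun Rplus g ->
  (\int[leb]_(x in Rplus) (g x ^+ 2)%:E < +oo)%E -> locally_integrable Rplus g.
Proof.
move=> mg g2; split=> [//||K KR cK]; first exact: itv_open_ends_open.
have mK : measurable K by exact: compact_measurable.
have mgK : measurable_fun K g by exact: measurable_funS mg.
have mg2 : measurable_fun Rplus (fun x => (g x ^+ 2)%:E).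
  by apply/measurable_EFinP; exact: measurable_funX.
apply: (@le_lt_trans _ _ (\int[leb]_(x in K) (1 + (g x ^+ 2)%:E))%E).
  apply: ge0_le_integral => //.
  - by apply/measurable_EFinP; exact: measurableT_comp.
  - by apply: emeasurable_funD => //; exact: measurable_funS mg2.
  - move=> x _; rewrite -EFinD lee_fin -real_normK ?num_real//.
    by have := sqr_ge0 (`|g x| - 2^-1); nra.
rewrite ge0_integralD//; last 2 first.
- by move=> x _; rewrite lee_fin sqr_ge0.
- exact: measurable_funS mg2.
rewrite lte_add_pinfty//.
  by rewrite integral_cst// mul1e; exact: compact_finite_measure.
apply: le_lt_trans g2; apply: ge0_subset_integral => //.
by move=> x _; rewrite lee_fin sqr_ge0.
Qed.

Lemma integral_young d (T : measurableType d) (R : realType)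
    (mu : {measure set T -> \bar R}) (D : set T) (f g : T -> R) (t : R) :
  measurable D -> measurable_fun D f -> measurable_fun D g -> 0 < t ->
  (\int[mu]_(x in D) `|f x * g x|%:E <= t^-1%:E * \int[mu]_(x in D) (f x ^+ 2)%:E
    + t%:E * \int[mu]_(x in D) (g x ^+ 2)%:E)%E.
Proof.
move=> mD mf mg t0.
have mf2 : measurable_fun D (fun x => (f x ^+ 2)%:E).
  by apply/measurable_EFinP; exact: measurable_funX.
have mg2 : measurable_fun D (fun x => (g x ^+ 2)%:E).
  by apply/measurable_EFinP; exact: measurable_funX.
have t1 : 0 <= t^-1 by rewrite invr_ge0 ltW.
rewrite -ge0_integralZl//; [|by move=> x _; rewrite lee_fin sqr_ge0].
rewrite -ge0_integralZl//; [|by move=> x _; rewrite lee_fin sqr_ge0|by rewrite lee_fin ltW].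
rewrite -ge0_integralD//; last 4 first.
- by move=> x _; rewrite -EFinM lee_fin mulr_ge0// sqr_ge0.
- exact: measurable_funeM.
- by move=> x _; rewrite -EFinM lee_fin mulr_ge0 ?sqr_ge0// ltW.
- exact: measurable_funeM.
apply: ge0_le_integral => //.
- by apply/measurable_EFinP; apply: measurableT_comp => //; exact: measurable_funM.
- by apply: emeasurable_funD; exact: measurable_funeM.
move=> x _; rewrite -!EFinM -EFinD lee_fin normrM.
rewrite -(real_normK (num_real (f x))) -(real_normK (num_real (g x))).
move: (normr_ge0 (f x)) (normr_ge0 (g x)); move: `|f x| `|g x| => p q p0 q0.
rewrite -subr_ge0.
have -> : t^-1 * p ^+ 2 + t * q ^+ 2 - p * q =
  t^-1 * (p - t * q) ^+ 2 + p * q by field; rewrite gt_eqF.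
by apply: addr_ge0; apply: mulr_ge0 => //; exact: sqr_ge0.
Qed.

Lemma integrable_EFinB d (T : measurableType d) {R : realType}
    (mu : {measure set T -> \bar R}) (A : set T) (f g : T -> R) : measurable A ->
  mu.-integrable A (EFin \o f) -> mu.-integrable A (EFin \o g) ->
  mu.-integrable A (EFin \o (fun x => f x - g x)).
Proof.
move=> mA If Ig; have -> : EFin \o (fun x => f x - g x) = ((EFin \o f) \- (EFin \o g))%E.
  by apply/funext => x.
exact: integrableB.
Qed.

Lemma measurable_derive1 {R : realType} (phi : R -> R) (D : set R) : test_function phi ->
  measurable_fun D (derive1 phi).
Proof.
move=> /test_function_derive1/test_function_csupp[+ _].
by move=> /continuous_measurable_fun mf; exact: measurable_funTS.
Qed.

Lemma h10_seq_dirichlet_bounded {R : realType} (phi : nat -> R -> R) (u : R -> R) :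
  h10_seq phi u -> exists N : nat, exists D : R, 0 <= D /\
  forall n, (N <= n)%N -> dirichlet (phi n) <= D.
Proof.
move=> [tp /(H10_cauchyP tp) cp _]; have [N NP] := cp 1 ltr01.
exists N, (2 * dirichlet (phi N) + 2); split.
  by rewrite addr_ge0// mulr_ge0// dirichlet_ge0.
move=> n Nn; rewrite -lee_fin -dirichletE// /H10_normsq.
apply: (le_trans (@sqr_integral_le _ _ _ leb Rplus _ (derive1 (phi N)) 1 _ _ _ _)) => //;
  [exact: measurable_derive1..|].
have := NP n N Nn (leqnn N).
rewrite -lte_fin -(dirichletE (test_functionB _ _))// /H10_normsq derive1B//.
move=> /ltW h.
rewrite invr1 -/(H10_normsq (phi N)) dirichletE// -EFinM [leRHS]EFinD.
by apply: leeD => //; rewrite -[leRHS]mule1; apply: lee_wpmul2l; rewrite // lee_fin.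
Qed.

Lemma h10_L2_derivative {R : realType} (phi : nat -> R -> R) (u : R -> R) :
  h10_seq phi u -> exists g : R -> R, measurable_fun Rplus g /\
  forall e : R, 0 < e -> exists N : nat, forall n : nat, (N <= n)%N ->
    (\int[leb]_(x in Rplus) ((derive1 (phi n) x - g x) ^+ 2)%:E <= e%:E)%E.
Proof.
move=> [tp /(H10_cauchyP tp) cp _].
apply: (@L2_complete _ _ _ leb Rplus (fun n => derive1 (phi n))) => //.
  by move=> n; exact: measurable_derive1.
move=> e e0; have [N NP] := cp e e0; exists N => m n Nm Nn.
have := NP m n Nm Nn; rewrite -lte_fin -(dirichletE (test_functionB _ _))//.
by rewrite /H10_normsq derive1B// => /ltW.
Qed.

Lemma L2_limit_finite {R : realType} (phi : R -> R) (g : R -> R) :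
  test_function phi -> measurable_fun Rplus g ->
  (\int[leb]_(x in Rplus) ((derive1 phi x - g x) ^+ 2)%:E < +oo)%E ->
  (\int[leb]_(x in Rplus) (g x ^+ 2)%:E < +oo)%E.
Proof.
move=> tp mg fin.
apply: (le_lt_trans (@sqr_integral_le _ _ _ leb Rplus _ (derive1 phi) 1 _ _ _ _)) => //.
  exact: measurable_derive1.
rewrite -/(H10_normsq phi) dirichletE// lte_add_pinfty// ?ltry//.
rewrite invr1 lte_mul_pinfty ?lee_fin//.
apply: le_lt_trans fin; apply: ge0_le_integral => //.
- by move=> x _; rewrite lee_fin sqr_ge0.
- apply/measurable_EFinP; apply: measurable_funX; apply: measurable_funB => //.
  exact: measurable_derive1.
- apply/measurable_EFinP; apply: measurable_funX; apply: measurable_funB => //.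
  exact: measurable_derive1.
- by move=> x _; rewrite -sqrrN opprB.
Qed.

Lemma L2_limit_test {R : realType} (phi : nat -> R -> R) (g psi : R -> R) :
  (forall n, test_function (phi n)) -> measurable_fun Rplus g ->
  (forall e : R, 0 < e -> exists N : nat, forall n : nat, (N <= n)%N ->
    (\int[leb]_(x in Rplus) ((derive1 (phi n) x - g x) ^+ 2)%:E <= e%:E)%E) ->
  locally_integrable Rplus g -> test_function psi ->
  \int[leb]_(x in Rplus) (derive1 (phi n) x * psi x) @[n --> \oo] -->
  \int[leb]_(x in Rplus) (g x * psi x).
Proof.
move=> tp mg glim lg tpsi.
have cpsi := test_function_csupp tpsi.
have ig : leb.-integrable Rplus (EFin \o (fun x => g x * psi x)).
  exact: locally_integrable_csupp.
have ip n : leb.-integrable Rplus (EFin \o (fun x => derive1 (phi n) x * psi x)).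
  apply: csupp_integrable => //; apply: csupp_mul; last by case: cpsi.
  exact/test_function_csupp/test_function_derive1.
have mpsi : measurable_fun Rplus psi.
  by apply: measurable_funTS; apply: continuous_measurable_fun; case: cpsi.
have ipsi2 := csupp_integrable measurable_Rplus (csupp_sqr cpsi).
set P := \int[leb]_(x in Rplus) (psi x ^+ 2).
have PE : (\int[leb]_(x in Rplus) (psi x ^+ 2)%:E = P%:E)%E.
  by rewrite /P /Rintegral fineK//; exact: integrable_fin_num.
have P0 : 0 <= P by apply: Rintegral_ge0 => x _; exact: sqr_ge0.
apply/cvgrPdist_le => e e0.
(* This choice gives [t * P <= e / 2], also for [P = 0]. The tolerance [t * (e / 2)] below absorbs
   the factor [t^-1] of the other term. *)
pose t := e / (2 * (P + 1)).
have t0 : 0 < t by rewrite divr_gt0// mulr_gt0// ltr_wpDl.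
have [N NP] := glim (t * (e / 2)) (mulr_gt0 t0 (divr_gt0 e0 (ltr0n _ 2))).
exists N => // n /= Nn.
rewrite distrC -RintegralB//.
have ib : leb.-integrable Rplus (EFin \o (fun x => derive1 (phi n) x * psi x - g x * psi x)).
  by apply: integrable_EFinB => //; exact: ip.
apply: (le_trans (le_normr_Rintegral _ ib)) => //.
rewrite -lee_fin /Rintegral fineK; last first.
  by apply: integrable_fin_num => //; exact: (integrable_abse ib).
have -> : (\int[leb]_(x in Rplus) `|derive1 (phi n) x * psi x - g x * psi x|%:E =
    \int[leb]_(x in Rplus) `|(derive1 (phi n) x - g x) * psi x|%:E)%E.
  by apply: eq_integral => x _; rewrite mulrBl.
have md : measurable_fun Rplus (fun x => derive1 (phi n) x - g x).
  by apply: measurable_funB => //; exact: measurable_derive1.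
apply: (le_trans (@integral_young _ _ _ leb Rplus _ psi t _ _ _ _)) => //.
rewrite PE -EFinM.
apply: (@le_trans _ _ ((e / 2)%:E + (e / 2)%:E)%E); last by rewrite -EFinD lee_fin -splitr.
apply: leeD.
  by rewrite lee_pdivrMl// -EFinM NP.
rewrite lee_fin /t.
have -> : e / (2 * (P + 1)) * P = (e / 2) * (P / (P + 1)).
  by field; rewrite gt_eqF// ltr_wpDl.
rewrite ger_pMr ?divr_gt0// ler_pdivrMr ?ltr_wpDl// mul1r.
by rewrite lerDl.
Qed.

Lemma h10_seq_test_lim {R : realType} (phi : nat -> R -> R) (u psi : R -> R) :
  h10_seq phi u -> measurable_fun Rplus u -> test_function psi ->
  leb.-integrable Rplus (EFin \o (fun x => u x * derive1 psi x)) /\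
  \int[leb]_(x in Rplus) (phi n x * derive1 psi x) @[n --> \oo] -->
  \int[leb]_(x in Rplus) (u x * derive1 psi x).
Proof.
move=> hphi mu tpsi; have [tp _ pu] := hphi.
have [N [D [D0 ND]]] := h10_seq_dirichlet_bounded hphi.
have cpsi := test_function_csupp (test_function_derive1 tpsi).
have mpsi := measurable_derive1 (D := Rplus) tpsi.
(* Dominating function: the absolute value of [phi n x] is at most [1 + phi n x ^+ 2], hence at most
   [1 + x * D] by the Hoelder bound at 0. As [D] bounds the energies only from [N] on, the sequence
   is shifted by [N]. *)
have ig : leb.-integrable Rplus (EFin \o (fun x => `|derive1 psi x| * (1 + x * D))).
  apply: csupp_integrable => //; apply: csupp_mul.
    case: cpsi => cp [a [b [a0 ab pab]]]; split.
      by move=> x; apply: cvg_norm; exact: cp.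
    by exists a, b; split => // x; rewrite normr_eq0; exact: pab.
  move=> x; apply: cvgD; first exact: cvg_cst.
  by apply: cvgM; [exact: cvg_id|exact: cvg_cst].
have mphi n : measurable_fun Rplus (phi n).
  apply: measurable_funTS; apply: continuous_measurable_fun.
  exact: (proj1 (test_function_csupp (tp n))).
have [||||iu _ lim] := @dominated_convergence _ _ _ leb Rplus measurable_Rplus
  (fun n x => (phi (n + N)%N x * derive1 psi x)%:E)
  (fun x => (u x * derive1 psi x)%:E) _ _ _ _ ig.
- by move=> n; apply/measurable_EFinP; apply: measurable_funM; [exact: mphi|exact: mpsi].
- by apply/measurable_EFinP; apply: measurable_funM; [exact: mu|exact: mpsi].
- apply: aeW => x; rewrite RplusE => x0; apply: cvg_EFin; first exact: nearW.
  apply: (@cvgM _ _ _ _ (fun n => phi (n + N)%N x) (cst (derive1 psi x))); last exact: cvg_cst.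
  by rewrite (cvg_shiftn N (phi ^~ x)); apply: pu; exact: ltW.
- apply: aeW => x n; rewrite RplusE => x0; rewrite lee_fin normrM mulrC ler_wpM2l//.
  have h1 := test_hoelder0 (tp (n + N)%N) (ltW x0).
  have h2 : x * dirichlet (phi (n + N)%N) <= x * D.
    by apply: ler_wpM2l; [exact: ltW|apply: ND; exact: leq_addl].
  rewrite -real_normK ?num_real// in h1.
  by have := sqr_ge0 (`|phi (n + N)%N x| - 1); nra.
split=> //.
rewrite -(cvg_shiftn N).
apply: (@cvg_comp _ _ _ (fun n => \int[leb]_(x in Rplus) (phi (n + N)%N x * derive1 psi x)%:E)%E
  fine _ (nbhs (\int[leb]_(x in Rplus) (u x * derive1 psi x)%:E)%E)).
  exact: lim.
have fu : ((\int[leb]_(x in Rplus) (u x * derive1 psi x)%:E) \is a fin_num)%E.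
  exact: integrable_fin_num.
by rewrite /Rintegral -{1}(fineK fu); exact: fine_cvg.
Qed.

(** Both sides of the integration by parts for [phi n] pass to the limit. Replacing [theta - beta]
    by [theta] adds [beta] times the integral of [derive1 psi], which is 0. *)
Lemma h10_is_weak_derivative {R : realType} (phi : nat -> R -> R) (theta g : R -> R) (beta : R) :
  h10_seq phi (fun x => theta x - beta) -> measurable_fun Rplus theta ->
  measurable_fun Rplus g ->
  (forall e : R, 0 < e -> exists N : nat, forall n : nat, (N <= n)%N ->
    (\int[leb]_(x in Rplus) ((derive1 (phi n) x - g x) ^+ 2)%:E <= e%:E)%E) ->
  is_weak_derivative theta g.
Proof.
move=> hphi mtheta mg glim; have [tp _ _] := hphi.
have g2 : (\int[leb]_(x in Rplus) (g x ^+ 2)%:E < +oo)%E.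
  have [N NP] := glim 1 ltr01; apply: (L2_limit_finite (tp N)) => //.
  by apply: le_lt_trans (NP N (leqnn N)) _; exact: ltry.
have lg := sqr_integrable_locally mg g2.
split=> // psi tpsi.
have mu : measurable_fun Rplus (fun x => theta x - beta) by exact: measurable_funB.
have [iu ulim] := h10_seq_test_lim hphi mu tpsi.
have glim' := L2_limit_test tp mg glim lg tpsi.
have ig : leb.-integrable Rplus (EFin \o (fun x => g x * psi x)).
  by apply: locally_integrable_csupp => //; exact: test_function_csupp.
have ip : leb.-integrable Rplus (EFin \o derive1 psi).
  by apply: csupp_integrable => //; exact/test_function_csupp/test_function_derive1.
have E : \int[leb]_(x in Rplus) ((theta x - beta) * derive1 psi x) =
    - \int[leb]_(x in Rplus) (g x * psi x).
  apply: (cvg_unique _ ulim) => //.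
  rewrite (_ : (fun n => _) = (fun n => - \int[leb]_(x in Rplus) (derive1 (phi n) x * psi x))).
    exact: cvgN.
  apply/funext => n; apply: integral_by_parts_test => //.
  by have [] := (test_functionP _).1 (tp n).
have iE : EFin \o (fun x => theta x * derive1 psi x) =
    EFin \o (fun x => (theta x - beta) * derive1 psi x - (- beta) * derive1 psi x).
  by apply/funext => x /=; congr EFin; ring.
have ibp : leb.-integrable Rplus (EFin \o (fun x => (- beta) * derive1 psi x)).
  exact: integrable_scale.
have it : leb.-integrable Rplus (EFin \o (fun x => theta x * derive1 psi x)).
  by rewrite iE; exact: integrable_EFinB.
rewrite -(fineK (integrable_fin_num _ it))// -(fineK (integrable_fin_num _ ig))// -EFinN.
congr EFin.
rewrite -[LHS]/(\int[leb]_(x in Rplus) (theta x * derive1 psi x)).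
rewrite -[X in _ = - X]/(\int[leb]_(x in Rplus) (g x * psi x)) -E.
have -> : \int[leb]_(x in Rplus) (theta x * derive1 psi x) =
    \int[leb]_(x in Rplus) ((theta x - beta) * derive1 psi x - (- beta) * derive1 psi x).
  by apply: eq_Rintegral => x _; ring.
rewrite RintegralB// [X in _ - X](_ : _ = 0) ?subr0//.
by rewrite RintegralZl// integral_derive1_test// mulr0.
Qed.

Lemma is_weak_derivative_uniq {R : realType} (beta : R) (eta u g h : R -> R) :
  0 < beta -> cutoff beta eta ->
  is_weak_derivative u g -> is_weak_derivative u h ->
  {ae leb, forall x, Rplus x -> g x - h x = 0}.
Proof.
move=> beta0 heta [lg gE] [lh hE].
apply: (locally_integrable_ae0 beta0 heta (h := fun x => g x - h x)).
  exact: locally_integrableB.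
move=> psi tpsi; have cpsi := test_function_csupp tpsi.
have ig := locally_integrable_csupp lg cpsi.
have ih := locally_integrable_csupp lh cpsi.
rewrite (_ : (\int[leb]_(x in Rplus) _ =
    \int[leb]_(x in Rplus) ((g x * psi x)%:E - (h x * psi x)%:E))%E).
  rewrite integralB//; have := hE _ tpsi; rewrite gE// => /oppe_inj ->.
  by rewrite subee//; exact: integrable_fin_num.
by apply: eq_integral => x _; rewrite -EFinB mulrBl.
Qed.

(** The choice made by [xget] is only known to be some weak derivative. By uniqueness it agrees
    almost everywhere with the L2 limit of the [derive1 (phi n)], and so inherits the convergence.
    The cutoff enters through uniqueness alone, hence its own level [b]. *)
Lemma weak_derivative_approx {R : realType} (b beta : R) (eta : R -> R)
    (phi : nat -> R -> R) (theta : R -> R) :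
  0 < b -> cutoff b eta ->
  h10_seq phi (fun x => theta x - beta) -> measurable_fun Rplus theta ->
  measurable_fun Rplus (weak_derivative theta) /\
  forall e : R, 0 < e -> exists N : nat, forall n : nat, (N <= n)%N ->
    (\int[leb]_(x in Rplus) ((derive1 (phi n) x - weak_derivative theta x) ^+ 2)%:E <= e%:E)%E.
Proof.
move=> b0 heta hphi mtheta; have [tp _ _] := hphi.
have [g [mg glim]] := h10_L2_derivative hphi.
have wg := h10_is_weak_derivative hphi mtheta mg glim.
have wd : is_weak_derivative theta (weak_derivative theta).
  exact: (@xgetPex _ (fun=> 0) [set g | is_weak_derivative theta g] (ex_intro _ g wg)).
have mw : measurable_fun Rplus (weak_derivative theta) by case: wd => [[]].
split=> // e e0; have [N NP] := glim e e0; exists N => n Nn.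
apply: le_trans (NP n Nn); rewrite le_eqVlt; apply/orP; left; apply/eqP.
have md (k : R -> R) : measurable_fun Rplus k ->
    measurable_fun Rplus (fun x => ((derive1 (phi n) x - k x) ^+ 2)%:E).
  move=> mk; apply/measurable_EFinP; apply: measurable_funX; apply: measurable_funB => //.
  exact: measurable_derive1.
apply: ae_eq_integral => //; [exact: md|exact: md|].
have := is_weak_derivative_uniq b0 heta wg wd.
apply: filterS; first exact: (ae_filter_ringOfSetsType leb).
move=> x gw x0.
by move: (gw x0) => /eqP; rewrite subr_eq0 => /eqP ->.
Qed.

(** * Weak lower semicontinuity of the Dirichlet energy *)

(* Equal to [lim dirichlet (phi n)] for [phi] approximating [theta - beta]. *)
Definition wdsq {R : realType} (theta : R -> R) : \bar R :=
  (\int[leb]_(x in Rplus) (weak_derivative theta x ^+ 2)%:E)%E.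

Lemma wdsq_ge0 {R : realType} (theta : R -> R) : (0 <= wdsq theta)%E.
Proof. by apply: integral_ge0 => x _; rewrite lee_fin sqr_ge0. Qed.

(** Closes applications of [sqr_integral_le]: first [t] is taken so small that [t * c <= e / 2],
    then [d] so small that its large factor [1 + t^-1] costs only [e / 2]. *)
Lemma young_parameters {R : realType} (c e : R) : 0 <= c -> 0 < e ->
  exists t d : R, [/\ 0 < t, 0 < d & (1 + t) * c + (1 + t^-1) * d <= c + e].
Proof.
move=> c0 e0; pose t := e / (2 * (c + 1)).
have c1 : 0 < c + 1 by rewrite ltr_wpDl.
have t0 : 0 < t by rewrite divr_gt0// mulr_gt0.
have t1 : 0 < 1 + t^-1 by rewrite addr_gt0// invr_gt0.
exists t, (e / 2 / (1 + t^-1)); split => //; first by apply: divr_gt0 => //; exact: divr_gt0.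
have -> : (1 + t^-1) * (e / 2 / (1 + t^-1)) = e / 2 by rewrite mulrC divfK// gt_eqF.
have tc : t * c <= e / 2.
  have -> : t * c = (e / 2) * (c / (c + 1)) by rewrite /t; field; rewrite gt_eqF.
  by rewrite ger_pMr ?divr_gt0// ler_pdivrMr// mul1r lerDl.
by lra.
Qed.

Section wdsq.
Context {R : realType} (b beta : R) (eta : R -> R).
Hypotheses (b0 : 0 < b) (heta : cutoff b eta).

(** The derivatives converge strongly, so a bound along infinitely many indices passes to the
    limit. *)
Lemma wdsq_le (phi : nat -> R -> R) (theta : R -> R) (c : R) :
  h10_seq phi (fun x => theta x - beta) -> measurable_fun Rplus theta -> 0 <= c ->
  (forall N, exists2 n, (N <= n)%N & dirichlet (phi n) <= c) -> (wdsq theta <= c%:E)%E.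
Proof.
move=> hphi mtheta c0 phic; have [tp _ _] := hphi.
have [mw wlim] := weak_derivative_approx b0 heta hphi mtheta.
apply/lee_addgt0Pr => e e0.
have [t [d [t0 d0 tde]]] := young_parameters c0 e0.
have [N NP] := wlim d d0; have [n Nn pc] := phic N.
apply: (le_trans (@sqr_integral_le _ _ _ leb Rplus _ (derive1 (phi n)) t _ _ _ _)) => //.
  exact: measurable_derive1.
rewrite -/(H10_normsq (phi n)) dirichletE//.
apply: (@le_trans _ _ ((1 + t)%:E * c%:E + (1 + t^-1)%:E * d%:E)%E); last first.
  by rewrite -!EFinM -!EFinD lee_fin.
have t1 : 0 <= 1 + t by rewrite addr_ge0// ltW.
have t2 : 0 <= 1 + t^-1 by rewrite addr_ge0// invr_ge0 ltW.
apply: leeD; first by rewrite lee_wpmul2l.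
rewrite lee_wpmul2l//; apply: le_trans (NP n Nn); rewrite le_eqVlt; apply/orP; left.
by apply/eqP; apply: eq_integral => x _; rewrite -sqrrN opprB.
Qed.

Lemma h10_seq_wdsq_lty (phi : nat -> R -> R) (theta : R -> R) :
  h10_seq phi (fun x => theta x - beta) -> measurable_fun Rplus theta ->
  (wdsq theta < +oo)%E.
Proof.
move=> hphi mtheta; have [tp _ _] := hphi.
have [mw wlim] := weak_derivative_approx b0 heta hphi mtheta.
have [N NP] := wlim 1 ltr01.
by apply: (L2_limit_finite (tp N)) => //; apply: le_lt_trans (NP N (leqnn N)) _; exact: ltry.
Qed.

(** A far enough term of the sequence does both: it allows a minimizing sequence to be traded for
    test functions, with control of the pointwise error and of the energy. *)
Lemma h10_seq_approx (phi : nat -> R -> R) (theta : R -> R) (e : R) :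
  h10_seq phi (fun x => theta x - beta) -> measurable_fun Rplus theta -> 0 < e ->
  exists psi, [/\ test_function psi,
    forall x, 0 <= x -> (psi x - (theta x - beta)) ^+ 2 <= x * e &
    ((dirichlet psi)%:E <= wdsq theta + e%:E)%E].
Proof.
move=> hphi mtheta e0; have [tp _ _] := hphi.
have [mw wlim] := weak_derivative_approx b0 heta hphi mtheta.
have Wfin := h10_seq_wdsq_lty hphi mtheta.
have W0 := wdsq_ge0 theta.
have WE : wdsq theta = (fine (wdsq theta))%:E by rewrite fineK// ge0_fin_numE.
have c0 : 0 <= fine (wdsq theta) by exact: fine_ge0.
have [t [d [t0 d0 tde]]] := young_parameters c0 e0.
have [N1 N1P] := wlim d d0; have [N2 N2P] := h10_seq_close hphi e0.
pose n := maxn N1 N2; exists (phi n); split => //.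
  by move=> x x0; apply: N2P => //; rewrite leq_maxr.
rewrite -dirichletE//.
apply: (le_trans (@sqr_integral_le _ _ _ leb Rplus _ (weak_derivative theta) t _ _ _ _)) => //.
  exact: measurable_derive1.
rewrite -/(wdsq theta) {1}WE.
apply: (@le_trans _ _ ((1 + t)%:E * (fine (wdsq theta))%:E + (1 + t^-1)%:E * d%:E)%E); last first.
  by rewrite [in leRHS]WE -!EFinM -!EFinD lee_fin.
have t2 : 0 <= 1 + t^-1 by rewrite addr_ge0// invr_ge0 ltW.
by apply: leeD => //; rewrite lee_wpmul2l// N1P// leq_maxl.
Qed.

End wdsq.

(* Midpoints suffice for the parallelogram argument, so general convex combinations are
   avoided. *)
Inductive midhull {R : realType} (phi : nat -> R -> R) (n : nat) : (R -> R) -> Prop :=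
| midhull_base k : (n <= k)%N -> midhull phi n (phi k)
| midhull_mid f g : midhull phi n f -> midhull phi n g ->
    midhull phi n (fun x => 2^-1 * f x + 2^-1 * g x).

Section mazur.
Context {R : realType} (phi : nat -> R -> R).
Hypothesis tp : forall n, test_function (phi n).

Lemma midhull_test n f : midhull phi n f -> test_function f.
Proof. by elim=> // *; exact: test_function_lincomb. Qed.

Lemma midhullS m n f : (m <= n)%N -> midhull phi n f -> midhull phi m f.
Proof.
move=> mn; elim=> [k nk|*]; last exact: midhull_mid.
by apply: midhull_base; exact: leq_trans nk.
Qed.

(** Intervals are midpoint-convex, so elements of the hulls of the tails keep the pointwise limit of
    the original sequence. *)
Lemma midhull_close n f (x c e : R) : midhull phi n f ->
  (forall k, (n <= k)%N -> `|phi k x - c| <= e) -> `|f x - c| <= e.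
Proof.
move=> hf H; elim: hf => [k nk|g h _ + _ +]; first exact: H.
rewrite !ler_norml => /andP[g1 g2] /andP[h1 h2].
by apply/andP; split; lra.
Qed.

Let S n := dirichlet @` [set f | midhull phi n f].
Let d n := inf (S n).

Let Slb n : has_lbound (S n).
Proof. by exists 0 => _ [f _ <-]; exact: dirichlet_ge0. Qed.

Let S0 n : S n !=set0.
Proof. by exists (dirichlet (phi n)); exists (phi n) => //; exact: midhull_base. Qed.

Let d_le n f : midhull phi n f -> d n <= dirichlet f.
Proof. by move=> hf; apply: ge_inf => //; exists f. Qed.

(** The infima [d n] over the hulls of the tails increase and stay below [M]. Two almost minimal
    elements from late tails have their midpoint in the hull of an earlier tail, whose infimum is
    already close to the supremum [L]; the parallelogram identity then makes their difference small.
    Each [phi k] lies in the hulls of the tails before it, so an energy level met infinitely often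
    bounds every [d n]. One [w] serves for all levels [c]. *)
Lemma mazur (u : R -> R) (M : R) :
  (forall n, dirichlet (phi n) <= M) ->
  (forall x, 0 <= x -> phi n x @[n --> \oo] --> u x) ->
  exists w, h10_seq w u /\ forall c : R,
    (forall n, exists2 k, (n <= k)%N & dirichlet (phi k) <= c) ->
    forall n, dirichlet (w n) <= c + n.+1%:R^-1.
Proof.
move=> phiM phiu.
have /choice[w wP] : forall n, exists f, midhull phi n f /\ dirichlet f < d n + n.+1%:R^-1.
  move=> n; have i0 : 0 < n.+1%:R^-1 :> R by rewrite invr_gt0.
  by have [_ [f hf <-] lt] := inf_adherent i0 (conj (S0 n) (Slb n)); exists f.
have tw n : test_function (w n) by exact: midhull_test (proj1 (wP n)).
exists w; split; last first.
  move=> c phic n; apply: (le_trans (ltW (proj2 (wP n)))); rewrite lerD2r.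
  by have [k nk kc] := phic n; apply: le_trans kc; apply: d_le; exact: midhull_base.
have dM n : d n <= M by apply: le_trans (phiM n); apply: d_le; exact: midhull_base.
have hd : has_sup (range d).
  by split; [exists (d 0%N); exists 0%N|exists M => _ [n _ <-]].
set L := sup (range d).
have dL n : d n <= L by apply: sup_upper_bound => //; exists n.
split=> //; last first.
  move=> x x0; apply/cvgrPdist_le => e e0.
  have [N _ NP] := (cvgrPdist_le _ _).1 (phiu x x0) e e0.
  exists N => // n /= Nn; rewrite distrC.
  apply: (midhull_close (proj1 (wP n))) => k nk; rewrite distrC.
  by apply: NP => /=; exact: leq_trans nk.
apply/(H10_cauchyP tw) => e e0.
(* A quarter of the energy of the difference is less than [(L + e / 8) - (L - e / 8) = e / 4]. *)
have e8 : 0 < e / 8 by rewrite divr_gt0.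
have [_ [N1 _ <-] N1L] := sup_adherent e8 hd; rewrite -/L in N1L.
have [N2 _ N2P] := near_infty_natSinv_lt (PosNum e8).
pose N := maxn N1 N2; exists N => m n Nm Nn.
have dN : d N1 <= d N.
  apply: lb_le_inf => // _ [f hf <-]; apply: d_le; apply: midhullS hf; exact: leq_maxl.
have hm := midhullS Nm (proj1 (wP m)); have hn := midhullS Nn (proj1 (wP n)).
have [_ qm] := wP m; have [_ qn] := wP n.
have im : m.+1%:R^-1 < e / 8 by apply: N2P => /=; apply: leq_trans Nm; exact: leq_maxr.
have jn : n.+1%:R^-1 < e / 8 by apply: N2P => /=; apply: leq_trans Nn; exact: leq_maxr.
have := d_le (midhull_mid hm hn); rewrite dirichlet_parallelogram//.
have A (p q r dm dn dk i j l : R) : dm <= l -> dn <= l -> l - e / 8 < dk -> i < e / 8 ->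
    j < e / 8 -> p < dm + i -> q < dn + j ->
    dk <= 2^-1 * p + 2^-1 * q + (- 4^-1) * r -> r < e.
  by clear; lra.
exact: A (dL m) (dL n) (lt_le_trans N1L dN) im jn qm qn.
Qed.

End mazur.

(** * Extraction of pointwise convergent subsequences *)

Section extraction.
Context {R : realType} (f : nat -> R -> R) (K : R).
Hypotheses (f0 : forall n, f n 0 = 0)
  (fK : forall n x y, 0 <= x -> 0 <= y -> `|f n x - f n y| <= K * Num.sqrt `|x - y|).

(** Tychonoff is applied to functions on the whole line while the bounds concern nonnegative points;
    on the negative side the value at 0 is kept. *)
Let g n : R -> R := fun x => f n (Num.max x 0).

(** Since [f n 0 = 0], the Hoelder bound confines each value [g n x] to a fixed segment, and a
    product of segments is compact. A neighbourhood in the product topology can prescribe finitely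
    many values, whence the finite list [s]. *)
Lemma extraction_cluster_point : exists u : R -> R,
  forall (k : nat) (e : R) (s : seq R), 0 < e ->
  exists2 n, (k <= n)%N & forall x, x \in s -> `|g n x - u x| < e.
Proof.
pose A (x : R) : set R :=
  [set` `[- (K * Num.sqrt (Num.max x 0)), K * Num.sqrt (Num.max x 0)]].
have cA : forall x, compact (A x) by move=> x; exact: segment_compact.
have gA n x : A x (g n x).
  rewrite /A /= in_itv /= -ler_norml.
  have m0 : 0 <= Num.max x 0 by rewrite le_max lexx orbT.
  by have := fK n m0 (lexx 0); rewrite f0 !subr0 (ger0_norm m0).
have [|u [_ ucl]] := tychonoff cA (F := fmap g \oo) _.
  by exists 0%N => // n _ x /=; exact: gA.
exists u => k e s e0.
have GA : (fmap g \oo) [set g n | n in [set n | (k <= n)%N]].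
  by exists k => // n /= kn; exists n.
have nB : nbhs u [set h | forall x, x \in s -> `|h x - u x| < e].
  elim: s => [|x s IH]; first exact: filterS filterT.
  have px := @proj_continuous R (fun=> R) x u.
  have bx : nbhs (proj x u) (ball (u x) e) by exact: nbhsx_ballx.
  have {px}bx : nbhs u [set h | ball (u x) e (h x)] by exact: px.
  apply: (@filterS _ (nbhs u) _ _ _ _ (filterI bx IH)) => h [/= hx hs] y.
  rewrite inE => /orP[/eqP ->|]; last exact: hs.
  by rewrite distrC; exact: hx.
have [h [[n kn <-] Bh]] := ucl _ _ GA nB.
by exists n.
Qed.

Lemma pointwise_extraction : 0 <= K -> exists (s : nat -> nat) (u : R -> R),
  (forall k, (k <= s k)%N) /\ forall x, 0 <= x -> f (s k) x @[k --> \oo] --> u x.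
Proof.
move=> K0; have [u uP] := extraction_cluster_point.
have gE n x : 0 <= x -> g n x = f n x by move=> x0; rewrite /g max_l.
have uK x y : 0 <= x -> 0 <= y -> `|u x - u y| <= K * Num.sqrt `|x - y|.
  move=> x0 y0; apply/ler_addgt0Pr => e e0.
  have e2 : 0 < e / 2 by rewrite divr_gt0.
  have [n _ nP] := uP 0%N (e / 2) [:: x; y] e2.
  have := nP x; rewrite inE eqxx gE// => /(_ isT) hx.
  have := nP y; rewrite !inE eqxx orbT gE// => /(_ isT) hy.
  have hxy := fK n x0 y0.
  have -> : u x - u y = (f n x - f n y) - (f n x - u x) + (f n y - u y) by ring.
  apply: (le_trans (ler_normD _ _)); rewrite [e]splitr addrA; apply: lerD; last exact: ltW.
  by apply: (le_trans (ler_normB _ _)); apply: lerD => //; exact: ltW.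
(* Cluster points for pointwise convergence need not be limits of subsequences, but
   equicontinuity makes approximation on finer and finer grids sufficient. *)
pose gr k := [seq (i%:R / k.+1%:R : R) | i <- iota 0 (k.+1 * k.+1).+1].
have /choice[s sP] : forall k : nat, exists n, (k <= n)%N /\
    forall x, x \in gr k -> `|g n x - u x| < k.+1%:R^-1.
  move=> k; have k0 : 0 < k.+1%:R^-1 :> R by rewrite invr_gt0.
  by have [n kn nP] := uP k _ (gr k) k0; exists n.
exists s, u; split=> [k|x x0]; first by have [] := sP k.
(* Error bound at any point within reach of the grid: one Hoelder error for [f (s k)] and one for
   [u] over a grid step, plus the error at the grid point. *)
pose a k : R := 2 * K * Num.sqrt k.+1%:R^-1 + k.+1%:R^-1.
have a0 : a k @[k --> \oo] --> 0.
  rewrite [X in _ --> X](_ : _ = 2 * K * Num.sqrt 0 + 0); last by rewrite sqrtr0 mulr0 addr0.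
  apply: cvgD; last exact: cvg_harmonic.
  apply: cvgM; first exact: cvg_cst.
  by apply: (continuous_cvg _ (@sqrt_continuous R 0)); exact: cvg_harmonic.
apply/cvgrPdist_le => e e0.
have [N1 _ N1P] := (cvgrPdist_le _ _).1 a0 e e0.
exists (maxn N1 (Num.truncn x)) => // k /= /[1!geq_max] /andP[N1k xk].
have k0 : 0 < k.+1%:R :> R by rewrite ltr0n.
pose i := Num.truncn (x * k.+1%:R).
have /andP[ix xi] : i%:R <= x * k.+1%:R < i.+1%:R by apply: truncn_itv; rewrite mulr_ge0// ltW.
pose y : R := i%:R / k.+1%:R.
have y0 : 0 <= y by rewrite divr_ge0.
have ygr : y \in gr k.
  apply/mapP; exists i => //; rewrite mem_iota /= add0n ltnS.
  rewrite -(ler_nat R) (le_trans ix)// natrM ler_pM2r// ltW//.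
  by apply: (lt_le_trans (truncnS_gt x)); rewrite ler_nat ltnS.
have xy : `|x - y| <= k.+1%:R^-1.
  have yx : y <= x by rewrite /y ler_pdivrMr.
  rewrite ger0_norm ?subr_ge0// lerBlDr -[X in X + y]mul1r -mulrDl ler_pdivlMr//.
  by rewrite addrC natr1 ltW.
have sxy : K * Num.sqrt `|x - y| <= K * Num.sqrt k.+1%:R^-1.
  by apply: ler_wpM2l => //; exact: ler_wsqrtr.
have [_ /(_ y ygr)] := sP k; rewrite gE// => h1.
have h2 := fK (s k) x0 y0; have h3 := uK x y x0 y0.
have := N1P k N1k; rewrite sub0r normrN => /(le_trans (ler_norm _)); apply: le_trans.
rewrite distrC.
have -> : f (s k) x - u x = (f (s k) x - f (s k) y) + (f (s k) y - u y) - (u x - u y) by ring.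
apply: (le_trans (ler_normB _ _)).
have := ler_normD (f (s k) x - f (s k) y) (f (s k) y - u y).
have A (p q r t c j : R) : t <= j -> p <= c -> r <= c -> q <= p + t -> q + r <= 2 * c + j.
  by clear; lra.
by rewrite /a -mulrA; exact: A (ltW h1) (le_trans h2 sxy) (le_trans h3 sxy).
Qed.

End extraction.

(** * Lower bound and decomposition of the energy *)

Lemma lipschitz_derive1 {R : realType} (f : R -> R) (a b L : R) : a <= b ->
  (forall x : R, derivable f x 1) ->
  (forall x, a <= x <= b -> `|derive1 f x| <= L) -> `|f b - f a| <= L * (b - a).
Proof.
rewrite le_eqVlt => /predU1P[->|ab] df fL; first by rewrite !subrr normr0 mulr0.
have [||c cab ->] := @MVT _ f (derive1 f) _ _ ab.
- by move=> x _; rewrite derive1E; exact: DeriveDef.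
- by apply: continuous_subspaceT; exact: derivable_continuous.
have ba0 : 0 <= b - a by rewrite subr_ge0 ltW.
rewrite normrM (ger0_norm ba0); apply: ler_wpM2r => //; apply: fL.
by move: cab; rewrite in_itv /= => /andP[/ltW -> /ltW ->].
Qed.

Lemma sin_lipschitz {R : realType} (x y : R) : `|sin x - sin y| <= `|x - y|.
Proof.
wlog xy : x y / y <= x.
  move=> H; have [|/ltW] := leP y x; first exact: H.
  by move=> /H; rewrite distrC (distrC y).
have xy0 : 0 <= x - y by rewrite subr_ge0.
rewrite (ger0_norm xy0) -[leRHS]mul1r.
apply: lipschitz_derive1 => // t _.
rewrite derive1E derive_val; exact: cos_max.
Qed.

Lemma sqr_sin_le {R : realType} (x : R) : sin x ^+ 2 <= x ^+ 2.
Proof.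
have := sin_lipschitz x 0; rewrite sin0 !subr0 => h.
by rewrite -(real_normK (num_real x)) -(real_normK (num_real (sin x))) lerXn2r.
Qed.

Lemma measurable_inv {R : realType} : measurable_fun setT (fun x : R => x^-1).
Proof.
rewrite -(setUv [set (0 : R)]); apply/measurable_funU => //; first exact: measurableC.
split; first exact: measurable_fun_set1.
apply: open_continuous_measurable_fun.
  by rewrite openC; exact: closed_eq.
by move=> x /[!inE] /= /eqP x0; exact: inv_continuous.
Qed.

Lemma sin_sqr_diff {R : realType} (t b : R) :
  sin (t - b) ^+ 2 - sin (- b) ^+ 2 = sin t * sin (t - 2 * b).
Proof.
have -> : t - 2 * b = (t - b) - b by ring.
have -> : sin t = sin ((t - b) + b) by rewrite subrK.
rewrite (sinD (t - b)) (sinB (t - b)) sinN.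
have h1 := cos2Dsin2 (t - b); have h2 := cos2Dsin2 b.
move: h1 h2; move: (sin (t - b)) (cos (t - b)) (sin b) (cos b) => s c s' c' h1 h2.
have -> : (s * c' + c * s') * (s * c' - c * s') = s ^+ 2 * c' ^+ 2 - c ^+ 2 * s' ^+ 2 by ring.
have -> : c' ^+ 2 = 1 - s' ^+ 2 by rewrite -h2; ring.
have -> : c ^+ 2 = 1 - s ^+ 2 by rewrite -h1; ring.
ring.
Qed.

(** The integral of a signed [f] is a difference of extended reals. Here the negative part of [f] is
    dominated by [h], hence has finite integral; if [f + h] has infinite integral, so does the
    positive part of [f], and both sides are [+oo]. *)
Lemma integral_add_integrable d (T : measurableType d) (R : realType)
    (mu : {measure set T -> \bar R}) (D : set T) (f h : T -> R) : measurable D ->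
  measurable_fun D f -> mu.-integrable D (EFin \o h) ->
  (forall x, D x -> 0 <= h x) -> (forall x, D x -> 0 <= f x + h x) ->
  (\int[mu]_(x in D) (f x)%:E =
   \int[mu]_(x in D) (f x + h x)%:E - \int[mu]_(x in D) (h x)%:E)%E.
Proof.
move=> mD mf ih h0 fh0.
have mh : measurable_fun D h by case/integrableP: ih => /measurable_EFinP.
have mfh : measurable_fun D (fun x => f x + h x) by exact: measurable_funD.
have hfin := integrable_fin_num mD ih.
have [fin|] := ltP (\int[mu]_(x in D) (f x + h x)%:E)%E +oo%E.
  have ifh : mu.-integrable D (EFin \o (fun x => f x + h x)).
    apply/integrableP; split; first exact/measurable_EFinP.
    apply: le_lt_trans fin; rewrite le_eqVlt; apply/orP; left; apply/eqP.
    apply: eq_integral => x /set_mem Dx /=; rewrite ger0_norm//; exact: fh0.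
  rewrite -integralB//; apply: eq_integral => x _.
  by rewrite -EFinB addrK.
rewrite leye_eq => /eqP E; rewrite E.
have -> : (+oo - \int[mu]_(x in D) (h x)%:E = +oo)%E.
  by move: hfin => /fineK <-.
rewrite integralE.
have nfin : (\int[mu]_(x in D) (EFin \o f)^\- x < +oo)%E.
  apply: (@le_lt_trans _ _ (\int[mu]_(x in D) (h x)%:E)%E); last by rewrite ltey_eq hfin.
  apply: ge0_le_integral => //.
  - exact/measurable_funeneg/measurable_EFinP.
  - exact/measurable_EFinP.
  move=> x Dx; rewrite funeneg.unlock /= ge_max !lee_fin (h0 _ Dx) andbT.
  by have := fh0 _ Dx; lra.
have pinf : (\int[mu]_(x in D) (EFin \o f)^\+ x = +oo)%E.
  apply/eqP; rewrite -leye_eq leNgt; apply/negP => pfin.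
  have : (\int[mu]_(x in D) (f x + h x)%:E < +oo)%E.
    apply: (@le_lt_trans _ _ (\int[mu]_(x in D) ((EFin \o f)^\+ x + (h x)%:E))%E).
      apply: ge0_le_integral => //.
      - exact/measurable_EFinP.
      - by apply: emeasurable_funD;
          [exact/measurable_funepos/measurable_EFinP|exact/measurable_EFinP].
      move=> x Dx; rewrite EFinD leeD2r//= funepos.unlock /=.
      by rewrite le_max lexx.
    rewrite ge0_integralD//; first by rewrite lte_add_pinfty// ltey_eq hfin.
    - exact/measurable_funepos/measurable_EFinP.
    - exact/measurable_EFinP.
  by rewrite E ltxx.
have nn : (\int[mu]_(x in D) (EFin \o f)^\- x \is a fin_num)%E.
  by rewrite ge0_fin_numE//; apply: integral_ge0.
by rewrite [X in (X - _)%E]pinf; move: nn => /fineK <-.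
Qed.

Lemma integrable_oneDsqrV {R : realType} (H : R) :
  leb.-integrable Rplus (EFin \o (fun x => H * (oneDsqr x)^-1)).
Proof.
have m : measurable_fun setT (fun x : R => (oneDsqr x)^-1).
  by apply: continuous_measurable_fun; exact: continuous_oneDsqrV.
have i : leb.-integrable `[0, +oo[ (EFin \o (fun x : R => (oneDsqr x)^-1)).
  apply/integrableP; split; first by apply/measurable_EFinP; exact: measurable_funTS.
  rewrite [X in (X < _)%E](_ : _ = \int[leb]_(x in `[0%R, +oo[) (oneDsqr x)^-1%:E)%E.
    by rewrite integral0y_oneDsqr ltry.
  apply: eq_integral => x _ /=; rewrite ger0_norm// invr_ge0.
apply: integrable_scale => //; apply: (integrableS _ _ _ i) => //.
by move=> x; rewrite RplusE /= in_itv /= andbT => /ltW.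
Qed.

Section energy.
Context {R : realType} (beta nu : R) (eta : R -> R).
Hypotheses (nu0 : 0 < nu) (heta : cutoff beta eta).

Definition potential (x t : R) : R := 2^-1 * sin t ^+ 2 +
  nu / (4 * pi) * ((sin (t - beta) ^+ 2 - sin (eta x - beta) ^+ 2) / x).

(** For [x <= 1], [eta 0 = beta] and the bound on the derivative give [sin (eta x - beta) ^+ 2 <= L
    ^+ 2 * x ^+ 2], which cancels the singularity of [1 / x]. For [x >= 1], [eta x = 0] and the
    numerator contains the factor [sin t]: Young's inequality spends half of the term
    [2^-1 * sin t ^+ 2] and leaves an error [(k / x) ^+ 2]. *)
Lemma potential_lower_bound : exists2 H : R, 0 <= H & forall x t : R, 0 < x ->
  4^-1 * sin t ^+ 2 <= potential x t + H * (oneDsqr x)^-1.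
Proof.
have [se e01 e0 e1 _] := heta.
have [L [L0 eL]] := cutoff_derive1_bounded heta.
pose k := nu / (4 * pi).
have k0 : 0 < k by rewrite divr_gt0// mulr_gt0// pi_gt0.
(* The two summands pay for the regions [x <= 1] and [x >= 1]; the factor 2 comes from [1 + x ^+ 2]
   being at most 2 in the first and at most [2 * x ^+ 2] in the second. *)
exists (2 * (k * L ^+ 2 + k ^+ 2)).
  by rewrite mulr_ge0// addr_ge0 ?sqr_ge0// mulr_ge0 ?sqr_ge0 ?ltW.
move=> x t x0; rewrite /potential -/k.
have D0 : 0 < oneDsqr x by apply: lt_le_trans (oneDsqr_ge1 x).
have kL0 : 0 <= k * L ^+ 2 by rewrite mulr_ge0 ?sqr_ge0 ?ltW.
have k20 : 0 <= k ^+ 2 by rewrite sqr_ge0.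
have s20 : 0 <= sin t ^+ 2 by rewrite sqr_ge0.
have [x1|/ltW x1] := leP x 1.
  have ex : `|eta x - beta| <= L * x.
    rewrite -(e0 0)// -[X in L * X]subr0; apply: lipschitz_derive1; first exact: ltW.
      exact: smooth_derivable.
    by move=> y _; apply: (le_trans (eL y)); rewrite ler_piMr// indicE lern1 leq_b1.
  have sx : sin (eta x - beta) ^+ 2 <= L ^+ 2 * x ^+ 2.
    apply: le_trans (sqr_sin_le _) _; rewrite -exprMn -(real_normK (num_real (eta x - beta))).
    have Lx0 : 0 <= L * x by rewrite mulr_ge0 // ltW.
    by rewrite lerXn2r ?nnegrE.
  have qx : - L ^+ 2 <= (sin (t - beta) ^+ 2 - sin (eta x - beta) ^+ 2) / x.
    rewrite ler_pdivlMr//; have := sqr_ge0 (sin (t - beta)).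
    have : L ^+ 2 * x ^+ 2 <= L ^+ 2 * x.
      by rewrite ler_wpM2l ?sqr_ge0// expr2 ger_pMr.
    by lra.
  have Dx : 2^-1 <= (oneDsqr x)^-1.
    have : x ^+ 2 <= 1 by rewrite exprn_ile1// ltW.
    by rewrite lef_pV2 ?posrE// /oneDsqr; lra.
  have h1 : k * - L ^+ 2 <= k * ((sin (t - beta) ^+ 2 - sin (eta x - beta) ^+ 2) / x).
    by rewrite ler_wpM2l// ltW.
  have h2 : 2 * (k * L ^+ 2 + k ^+ 2) * 2^-1 <= 2 * (k * L ^+ 2 + k ^+ 2) * (oneDsqr x)^-1.
    by rewrite ler_wpM2l// mulr_ge0// addr_ge0.
  rewrite mulrN in h1.
  have A (a b m n s : R) : - m <= a -> 2 * (m + n) * 2^-1 <= b -> 0 <= m -> 0 <= n ->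
      0 <= s -> 4^-1 * s <= 2^-1 * s + a + b by clear; lra.
  exact: A h1 h2 kL0 k20 s20.
rewrite e1// sub0r sin_sqr_diff.
have Dx : (2 * x ^+ 2)^-1 <= (oneDsqr x)^-1.
  rewrite lef_pV2 ?posrE ?mulr_gt0 ?exprn_gt0// /oneDsqr.
  by have x21 : 1 <= x ^+ 2; [rewrite exprn_ege1|lra].
have h2 : 2 * (k * L ^+ 2 + k ^+ 2) * (2 * x ^+ 2)^-1 <=
    2 * (k * L ^+ 2 + k ^+ 2) * (oneDsqr x)^-1.
  by rewrite ler_wpM2l// mulr_ge0// addr_ge0.
have h3 : (k / x) ^+ 2 <= 2 * (k * L ^+ 2 + k ^+ 2) * (2 * x ^+ 2)^-1.
  have -> : 2 * (k * L ^+ 2 + k ^+ 2) * (2 * x ^+ 2)^-1 = (k * L ^+ 2 + k ^+ 2) / x ^+ 2.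
    by field; rewrite gt_eqF.
  by rewrite expr_div_n ler_wpM2r ?invr_ge0 ?sqr_ge0// lerDr.
have h4 : - (k / x) * `|sin t| <= k * (sin t * sin (t - 2 * beta) / x).
  have -> : k * (sin t * sin (t - 2 * beta) / x) = (k / x) * (sin t * sin (t - 2 * beta)) by ring.
  rewrite mulNr -mulrN ler_wpM2l//; first by rewrite ltW// divr_gt0.
  rewrite lerNl (le_trans (ler_norm _))// normrN normrM ler_piMr//.
  exact: sin_max.
rewrite -(real_normK (num_real (sin t))).
have A (p q r a b : R) : r <= b -> p ^+ 2 <= r -> - p * q <= a ->
    4^-1 * q ^+ 2 <= 2^-1 * q ^+ 2 + a + b.
  by clear => rb pr qa; have := sqr_ge0 (2^-1 * q - p); lra.
exact: A h2 h3 h4.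
Qed.

End energy.

(** * Measurability of the integrands of the energy *)

Lemma within_Rplus_bar_measurable {R : realType} (f : R -> R) :
  {within Rplus_bar, continuous f} -> measurable_fun Rplus f.
Proof.
move=> cf; have m : measurable_fun Rplus_bar f.
  by apply: subspace_continuous_measurable_fun => //; exact: measurable_itv.
apply: measurable_funS m; first exact: measurable_itv.
by move=> x; rewrite RplusE /Rplus_bar /= in_itv /= andbT => /ltW.
Qed.

Lemma admissible_measurable {R : realType} (beta : R) (theta : R -> R) :
  admissible beta theta -> measurable_fun Rplus theta.
Proof. by case=> /within_Rplus_bar_measurable. Qed.

Lemma measurable_sin_comp {R : realType} (f : R -> R) : measurable_fun Rplus f ->
  measurable_fun Rplus (fun x => sin (f x)).
Proof.
move=> mf; apply: measurableT_comp => //.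
by apply: continuous_measurable_fun; exact: continuous_sin.
Qed.

Lemma measurable_potential {R : realType} (beta nu : R) (eta theta : R -> R) :
  measurable_fun Rplus eta -> measurable_fun Rplus theta ->
  measurable_fun Rplus (fun x => potential beta nu eta x (theta x)).
Proof.
move=> me mt; rewrite /potential; apply: measurable_funD.
  by apply: measurable_funM => //; apply: measurable_funX; exact: measurable_sin_comp.
apply: measurable_funM => //; apply: measurable_funM.
  apply: measurable_funB; apply: measurable_funX; apply: measurable_sin_comp;
    exact: measurable_funB.
exact: measurable_funTS measurable_inv.
Qed.

Section energy_decomposition.
Context {R : realType} (beta nu H : R) (eta : R -> R).
Hypotheses (beta0 : 0 < beta) (heta : cutoff beta eta) (H0 : 0 <= H)
  (potH : forall x t : R, 0 < x ->
    4^-1 * sin t ^+ 2 <= potential beta nu eta x t + H * (oneDsqr x)^-1).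

Definition potential_energy (theta : R -> R) : \bar R :=
  (\int[leb]_(x in Rplus) (potential beta nu eta x (theta x) + H * (oneDsqr x)^-1)%:E)%E.

(* The renormalized energy up to the two constants of [renormalized_energyE]. *)
Definition positive_energy (theta : R -> R) : \bar R :=
  ((2^-1)%:E * wdsq theta + potential_energy theta
    + (nu / (8 * pi))%:E * nonlocal_energy beta theta)%E.

Let eta_meas : measurable_fun Rplus eta.
Proof.
have [se _ _ _ _] := heta; apply: measurable_funTS.
exact: (continuous_measurable_fun (smooth_continuous se)).
Qed.

Lemma potentialH_ge0 (x t : R) : 0 < x ->
  0 <= potential beta nu eta x t + H * (oneDsqr x)^-1.
Proof. by move=> x0; apply: le_trans (potH t x0); rewrite mulr_ge0 ?sqr_ge0. Qed.

Lemma measurable_potentialH (theta : R -> R) : measurable_fun Rplus theta ->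
  measurable_fun Rplus (fun x => potential beta nu eta x (theta x) + H * (oneDsqr x)^-1).
Proof.
move=> mt; apply: measurable_funD; first exact: measurable_potential.
apply: measurable_funTS; apply: measurable_funM => //.
by apply: continuous_measurable_fun; exact: continuous_oneDsqrV.
Qed.

Lemma potential_energy_ge0 (theta : R -> R) : (0 <= potential_energy theta)%E.
Proof.
by apply: integral_ge0 => x; rewrite RplusE lee_fin => x0; exact: potentialH_ge0.
Qed.

Lemma nonlocal_energy_ge0 (theta : R -> R) : (0 <= nonlocal_energy beta theta)%E.
Proof.
apply: integral_ge0 => y _; apply: integral_ge0 => x _.
by rewrite lee_fin mulr_ge0 ?invr_ge0 ?sqr_ge0.
Qed.

Lemma local_energyE (theta : R -> R) : admissible beta theta ->
  local_energy beta nu eta theta = ((2^-1)%:E * wdsq theta + potential_energy theta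
    - \int[leb]_(x in Rplus) (H * (oneDsqr x)^-1)%:E)%E.
Proof.
move=> ath; have mt := admissible_measurable ath.
have [_ [phi hphi]] := ath.
have [mw _] := weak_derivative_approx beta0 heta hphi mt.
have mw2 : measurable_fun Rplus (fun x => 2^-1 * weak_derivative theta x ^+ 2).
  by apply: measurable_funM => //; exact: measurable_funX.
rewrite /local_energy.
have -> : (\int[leb]_(x in Rplus)
    (2^-1 * `|weak_derivative theta x| ^+ 2 + 2^-1 * sin (theta x) ^+ 2
     + nu / (4 * pi) *
       ((sin (theta x - beta) ^+ 2 - sin (eta x - beta) ^+ 2) / x))%:E =
    \int[leb]_(x in Rplus) (2^-1 * weak_derivative theta x ^+ 2 +
      potential beta nu eta x (theta x))%:E)%E.
  apply: eq_integral => x _; rewrite real_normK ?num_real// /potential.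
  by rewrite addrA.
have oh x : 0 <= H * (oneDsqr x)^-1.
  by rewrite mulr_ge0// invr_ge0; apply: le_trans (oneDsqr_ge1 x).
rewrite (@integral_add_integrable _ _ _ leb Rplus
  (fun x => 2^-1 * weak_derivative theta x ^+ 2 + potential beta nu eta x (theta x))
  (fun x => H * (oneDsqr x)^-1)) //; last 3 first.
- apply: measurable_funD; [exact: mw2|exact: measurable_potential].
- exact: integrable_oneDsqrV.
- move=> x; rewrite RplusE => x0; rewrite -addrA addr_ge0 ?potentialH_ge0//.
  by rewrite mulr_ge0 ?sqr_ge0.
congr (_ - _)%E.
rewrite /wdsq -ge0_integralZl//; last 2 first.
- by apply/measurable_EFinP; exact: measurable_funX.
- by move=> x _; rewrite lee_fin sqr_ge0.
rewrite -ge0_integralD//; last 4 first.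
- by move=> x _; rewrite -EFinM lee_fin mulr_ge0 ?sqr_ge0.
- by apply: measurable_funeM; apply/measurable_EFinP; exact: measurable_funX.
- by move=> x; rewrite RplusE lee_fin => x0; exact: potentialH_ge0.
- by apply/measurable_EFinP; exact: measurable_potentialH.
by apply: eq_integral => x _; rewrite -EFinM -EFinD -addrA.
Qed.

(* Holds even if the last term is [+oo], both sides being then [-oo]. *)
Lemma renormalized_energyE (theta : R -> R) : admissible beta theta ->
  renormalized_energy beta nu eta theta = (positive_energy theta
    - \int[leb]_(x in Rplus) (H * (oneDsqr x)^-1)%:E
    - (nu / (8 * pi))%:E * nonlocal_energy beta eta)%E.
Proof.
move=> ath; rewrite /renormalized_energy local_energyE// /positive_energy.
by congr (_ - _)%E; rewrite addeAC.
Qed.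

Lemma potential_energy_fatou (theta : R -> R) (th : nat -> R -> R) :
  (forall n, measurable_fun Rplus (th n)) -> measurable_fun Rplus theta ->
  (forall x, 0 < x -> th n x @[n --> \oo] --> theta x) ->
  (potential_energy theta <= limn_einf (fun n => potential_energy (th n)))%E.
Proof.
move=> mth mt lim; apply: fatou_ae => //.
- by move=> n; apply/measurable_EFinP; exact: measurable_potentialH.
- by move=> n x; rewrite RplusE lee_fin => x0; exact: potentialH_ge0.
- by apply/measurable_EFinP; exact: measurable_potentialH.
apply: aeW => x; rewrite RplusE => x0; apply: cvg_EFin; first exact: nearW.
have sc (c : R) : sin (th n x - c) @[n --> \oo] --> sin (theta x - c).
  apply: (continuous_cvg _ (@continuous_sin R _)).
  by apply: cvgB; [exact: lim|exact: cvg_cst].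
have sc2 (c : R) : sin (th n x - c) ^+ 2 @[n --> \oo] --> sin (theta x - c) ^+ 2.
  by apply: (continuous_cvg _ (@exprn_continuous _ 2 _)); exact: sc.
apply: cvgD; last exact: cvg_cst.
apply: cvgD.
  apply: cvgM; first exact: cvg_cst.
  by have := sc2 0; under eq_fun do rewrite subr0; rewrite subr0.
apply: cvgM; first exact: cvg_cst.
apply: cvgM; last exact: cvg_cst.
by apply: cvgB; [exact: sc2|exact: cvg_cst].
Qed.

End energy_decomposition.

(** * The nonlocal term *)

Section nonlocal.
Context {R : realType} (beta : R).

Let K (f : R -> R) (x y : R) : \bar R :=
  ((sin (f x - beta) - sin (f y - beta)) ^+ 2 / (x - y) ^+ 2)%:E.

Let K_ge0 f x y : (0 <= K f x y)%E.
Proof. by rewrite lee_fin mulr_ge0 ?invr_ge0 ?sqr_ge0. Qed.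

Let measurable_K (f : R -> R) (y : R) : measurable_fun Rplus f ->
  measurable_fun Rplus (fun x => K f x y).
Proof.
move=> mf; apply/measurable_EFinP; apply: measurable_funM.
  apply: measurable_funX; apply: measurable_funB => //.
  by apply: measurable_sin_comp; exact: measurable_funB.
apply: measurable_funTS; apply: (measurableT_comp measurable_inv).
by apply: measurable_funX; exact: measurable_funB.
Qed.

(** Tonelli's theorem is applied on the full product, so the sine is extended by 0 off [Rplus] and
    an indicator restricts the inner variable. *)
Let measurable_inner (f : R -> R) : measurable_fun Rplus f ->
  measurable_fun Rplus (fun y => \int[leb]_(x in Rplus) K f x y)%E.
Proof.
move=> mf; pose s := (fun x => sin (f x - beta)) \_ Rplus.
have ms : measurable_fun setT s.
  apply/(measurable_restrictT _ _).1 => //.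
  by apply: measurable_sin_comp; exact: measurable_funB.
pose F (z : R * R) : \bar R :=
  ((s z.1 - s z.2) ^+ 2 / (z.1 - z.2) ^+ 2 * \1_Rplus z.1)%:E.
have mF : measurable_fun setT F.
  apply/measurable_EFinP; apply: measurable_funM; last first.
    by apply: measurableT_comp => //; exact: measurable_fst.
  apply: measurable_funM.
    apply: measurable_funX; apply: measurable_funB.
      by apply: (measurableT_comp ms); exact: measurable_fst.
    by apply: (measurableT_comp ms); exact: measurable_snd.
  apply: (measurableT_comp measurable_inv); apply: measurable_funX.
  by apply: measurable_funB; [exact: measurable_fst|exact: measurable_snd].
have F0 z : (0 <= F z)%E.
  rewrite lee_fin; apply: mulr_ge0; last by rewrite indicE.
  by apply: mulr_ge0; rewrite ?invr_ge0; exact: sqr_ge0.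
have mG := measurable_fun_fubini_tonelli_G (m1 := leb) F mF F0.
apply: (@eq_measurable_fun _ _ _ _ _ (fubini_G leb F)); last exact: measurable_funTS mG.
move=> y /set_mem yR; rewrite /fubini_G [RHS]integral_mkcond; apply: eq_integral => x _.
rewrite patchE /F /s indicE; case: ifPn => xR; last by rewrite mulr0.
by rewrite !patchE xR mem_set// mulr1.
Qed.

(** Fatou twice: in [x] for each fixed [y], then in [y]. *)
Lemma nonlocal_energy_fatou (theta : R -> R) (th : nat -> R -> R) :
  (forall n, measurable_fun Rplus (th n)) -> measurable_fun Rplus theta ->
  (forall x, 0 < x -> th n x @[n --> \oo] --> theta x) ->
  (nonlocal_energy beta theta <= limn_einf (fun n => nonlocal_energy beta (th n)))%E.
Proof.
move=> mth mt lim; rewrite /nonlocal_energy.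
apply: (@le_trans _ _ (\int[leb]_(y in Rplus)
    limn_einf (fun n => \int[leb]_(x in Rplus) K (th n) x y))%E); last first.
  apply: fatou => //.
  - by move=> n; exact: measurable_inner.
  - by move=> n y _; apply: integral_ge0 => x _; exact: K_ge0.
apply: ge0_le_integral => //.
- by move=> y _; apply: integral_ge0 => x _; exact: K_ge0.
- exact: measurable_inner.
- by apply: measurable_fun_limn_einf => n; exact: measurable_inner.
move=> y; rewrite RplusE => y0; apply: fatou_ae => //.
- by move=> n; exact: measurable_K.
- exact: measurable_K.
apply: aeW => x; rewrite RplusE => x0; apply: cvg_EFin; first exact: nearW.
have sc z : 0 < z -> sin (th n z - beta) @[n --> \oo] --> sin (theta z - beta).
  move=> z0; apply: (continuous_cvg _ (@continuous_sin R _)).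
  by apply: cvgB; [exact: lim|exact: cvg_cst].
apply: cvgM; last exact: cvg_cst.
apply: (continuous_cvg _ (@exprn_continuous _ 2 _)).
by apply: cvgB; exact: sc.
Qed.

End nonlocal.

(** * Behaviour at infinity *)

(** If [sin (theta x)] exceeds [e] in absolute value, it stays above [e / 2] on [[x, x + d]] with
    [d] independent of [x]. The integral beyond [n] is then at least [(e / 2) ^+ 2 * d], whereas
    these tails tend to 0. *)
Lemma hoelder_sin_cvg0 {R : realType} (theta : R -> R) (K : R) : 0 <= K ->
  (forall x y, 0 <= x -> 0 <= y -> `|theta x - theta y| <= K * Num.sqrt `|x - y|) ->
  measurable_fun Rplus theta ->
  (\int[leb]_(x in Rplus) (sin (theta x) ^+ 2)%:E < +oo)%E ->
  sin (theta x) @[x --> +oo] --> 0.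
Proof.
move=> K0 hK mt fin.
have ms : measurable_fun Rplus (fun x => sin (theta x) ^+ 2).
  by apply: measurable_funX; exact: measurable_sin_comp.
have is2 : leb.-integrable Rplus (fun x => (sin (theta x) ^+ 2)%:E).
  apply/integrableP; split; first exact/measurable_EFinP.
  apply: le_lt_trans fin; rewrite le_eqVlt; apply/orP; left; apply/eqP.
  by apply: eq_integral => x _ /=; rewrite ger0_norm// sqr_ge0.
pose tail n : \bar R :=
  (\int[leb]_(x in Rplus) (sin (theta x) ^+ 2 * \1_(`]n%:R, +oo[%classic) x)%:E)%E.
have mtail (n : nat) :
    measurable_fun Rplus (fun x => sin (theta x) ^+ 2 * \1_(`]n%:R, +oo[%classic) x).
  by apply: measurable_funM => //; apply: measurable_indic; exact: measurable_itv.
have tail0 : tail n @[n --> \oo] --> 0%E.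
  have [||||_ _ lim] := @dominated_convergence _ _ _ leb Rplus measurable_Rplus
    (fun n x => (sin (theta x) ^+ 2 * \1_(`]n%:R, +oo[%classic) x)%:E) (cst 0%E) _ _ _ _ is2.
  - by move=> n; apply/measurable_EFinP; exact: mtail.
  - by [].
  - apply: aeW => x _; apply: cvg_near_cst.
    exists (Num.truncn x).+1 => // n /= xn; rewrite indicE memNset ?mulr0//.
    rewrite /= in_itv /= andbT; apply/negP; rewrite -leNgt.
    by apply: (le_trans (ltW (truncnS_gt x))); rewrite ler_nat.
  - apply: aeW => x n _; rewrite lee_fin indicE.
    have s0 := sqr_ge0 (sin (theta x)).
    by case: (x \in _); rewrite ?mulr1 ?mulr0 ?normr0// ger0_norm.
  by move: lim; rewrite integral0.
apply/cvgrPdist_le => e e0.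
(* Chosen so that the Hoelder oscillation [K * Num.sqrt d] is at most [e / 2]; [K + 1] allows
   [K = 0]. *)
pose d := (e / (2 * (K + 1))) ^+ 2.
have K1 : 0 < K + 1 by rewrite ltr_wpDl.
have q0 : 0 < e / (2 * (K + 1)) by rewrite divr_gt0// mulr_gt0.
have d0 : 0 < d by rewrite exprn_gt0.
have Kd : K * Num.sqrt d <= e / 2.
  rewrite /d sqrtr_sqr gtr0_norm//.
  have -> : K * (e / (2 * (K + 1))) = (e / 2) * (K / (K + 1)) by field; rewrite gt_eqF.
  by rewrite ger_pMr ?divr_gt0// ler_pdivrMr// mul1r lerDl.
have c0 : 0 < (e / 2) ^+ 2 * d by rewrite mulr_gt0// exprn_gt0// divr_gt0.
have [n nc] : exists n, (tail n < ((e / 2) ^+ 2 * d)%:E)%E.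
  have /fine_cvgP[fn /cvgr_lt/(_ _ c0) lt] := tail0.
  have [N _ NP] := filterI fn lt; exists N.
  by have [Nf Nlt] := NP N (leqnn N); rewrite -(fineK Nf) lte_fin.
near=> x.
have xn : n%:R < x by near: x; exact: nbhs_pinfty_gt.
rewrite sub0r normrN leNgt; apply/negP => ex.
have x0 : 0 < x by apply: le_lt_trans xn.
have low y : x <= y <= x + d -> (e / 2) ^+ 2 <= sin (theta y) ^+ 2.
  move=> /andP[xy yx]; rewrite -(real_normK (num_real (sin _))).
  have e2 : 0 <= e / 2 by rewrite divr_ge0// ltW.
  rewrite lerXn2r ?nnegrE//.
  have h1 := sin_lipschitz (theta x) (theta y).
  have h2 := hK x y (ltW x0) (le_trans (ltW x0) xy).
  have h3 : K * Num.sqrt `|x - y| <= K * Num.sqrt d.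
    rewrite ler_wpM2l// ler_wsqrtr// distrC ger0_norm ?subr_ge0//.
    by rewrite lerBlDl.
  have := ler_normD (sin (theta x) - sin (theta y)) (sin (theta y)).
  rewrite subrK; lra.
move: nc; apply/negP; rewrite -leNgt.
pose I : set R := [set` `[x, x + d]].
have mI : measurable I by exact: measurable_itv.
have sub : I `<=` Rplus.
  by move=> y; rewrite RplusE /I /= in_itv /= => /andP[xy _]; exact: lt_le_trans xy.
have A1 : (((e / 2) ^+ 2 * d)%:E <= \int[leb]_(y in I) ((e / 2) ^+ 2)%:E)%E.
  rewrite integral_cst//= /I lebesgue_measure_itv /= lte_fin ltrDl d0 -EFinB -EFinM.
  by rewrite lee_fin addrAC subrr add0r.
have A2 : (\int[leb]_(y in I) ((e / 2) ^+ 2)%:E <=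
    \int[leb]_(y in I) (sin (theta y) ^+ 2 * \1_(`]n%:R, +oo[%classic) y)%:E)%E.
  apply: ge0_le_integral => //.
  - by move=> y _; rewrite lee_fin sqr_ge0.
  - by apply/measurable_EFinP; apply: measurable_funS (mtail n).
  move=> y; rewrite /I /= in_itv /= => /andP[xy yx]; rewrite lee_fin indicE mem_set ?mulr1.
    by rewrite low// xy.
  by rewrite /= in_itv /= andbT (lt_le_trans xn).
have A3 :
    (\int[leb]_(y in I) (sin (theta y) ^+ 2 * \1_(`]n%:R, +oo[%classic) y)%:E <= tail n)%E.
  apply: ge0_subset_integral => //.
  - by apply/measurable_EFinP; exact: mtail.
  - by move=> y _; rewrite lee_fin mulr_ge0 ?sqr_ge0// indicE.
exact: le_trans A1 (le_trans A2 A3).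
Unshelve. all: by end_near. Qed.

Lemma sin_sqr_periodic {R : realType} (k : int) (t : R) :
  sin (t - k%:~R * pi) ^+ 2 = sin t ^+ 2.
Proof.
have nat_case (n : nat) (u : R) : sin (u + n%:R * pi) ^+ 2 = sin u ^+ 2.
  elim: n => [|n IH]; first by rewrite mul0r addr0.
  by rewrite -natr1 mulrDl mul1r addrA sinDpi sqrrN.
case: k => n.
  by rewrite -(nat_case n) /= subrK.
by rewrite NegzE mulrNz mulNr opprK; exact: nat_case.
Qed.

(** From some [X] on, the sine has absolute value less than 1. Rounding [theta X / pi] to the
    nearest integer [k] puts [psi X] in [[- pi / 2, pi / 2]], and [psi] cannot leave this interval:
    by the intermediate value theorem it would meet a point where the sine is 1 or -1. There [asin]
    inverts [sin], so [psi] tends to 0. Squares are compared because the shift by [k] multiples of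
    [pi] may change the sign of the sine. *)
Lemma sin_cvg0_cvg_pi {R : realType} (theta : R -> R) :
  {within Rplus_bar, continuous theta} -> sin (theta x) @[x --> +oo] --> 0 ->
  exists k : int, theta x @[x --> +oo] --> (k%:~R * pi : R).
Proof.
move=> cth s0; have pi0 := pi_gt0 R.
have [X [X0 XP]] : exists X : R, 0 < X /\ forall x, X <= x -> `|sin (theta x)| < 1.
  have [M [_ MP]] := (cvgrPdist_lt _ _).1 s0 1 ltr01.
  exists (Num.max (M + 1) 1); split; first by rewrite lt_max ltr01 orbT.
  move=> x; rewrite ge_max => /andP[Mx _]; rewrite -normrN -[- _]sub0r; apply: MP.
  by apply: lt_le_trans Mx; rewrite ltrDl.
pose k := Num.floor (theta X / pi + 2^-1); exists k.
pose psi x := theta x - k%:~R * pi.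
have psi2 x : sin (psi x) ^+ 2 = sin (theta x) ^+ 2 by exact: sin_sqr_periodic.
have psiX : `|psi X| <= pi / 2.
  have /andP[k1 k2] := floor_itv (theta X / pi + 2^-1).
  rewrite -/k intrD in k1 k2; rewrite /psi ler_norml.
  have E : theta X = (theta X / pi) * pi by rewrite divfK// gt_eqF.
  rewrite E; move: k1 k2; move: (theta X / pi) (k%:~R : R) => p q k1 k2.
  have -> : p * pi - q * pi = (p - q) * pi by ring.
  rewrite [pi / 2]mulrC -mulNr !ler_pM2r//; change (1%:~R : R) with (1 : R) in k2.
  by apply/andP; split; lra.
have npi2 x : X <= x -> `|psi x| != pi / 2.
  move=> Xx; apply: contraTneq (XP x Xx) => pe; rewrite -leNgt.
  have : `|sin (theta x)| ^+ 2 = 1.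
    rewrite real_normK ?num_real// -psi2.
    have [p0|p0] := leP 0 (psi x).
      by rewrite ger0_norm// in pe; rewrite pe sin_pihalf expr1n.
    rewrite ltr0_norm// in pe; rewrite -[psi x]opprK pe sinN sin_pihalf.
    by rewrite sqrrN expr1n.
  by move=> /eqP; rewrite sqrp_eq1// => /eqP ->.
have cpsi x : X <= x -> {within `[X, x], continuous (fun t => `|psi t|)}.
  move=> Xx.
  have cX : {within `[X, x], continuous theta}.
    apply: continuous_subspaceW cth => t; rewrite /Rplus_bar /= !in_itv /= andbT.
    by move=> /andP[Xt _]; apply: le_trans Xt; exact: ltW.
  move=> t; apply: cvg_norm; apply: cvgB; last exact: cvg_cst.
  exact: cX.
have small x : X <= x -> `|psi x| < pi / 2.
  move=> Xx; rewrite ltNge; apply/negP => px.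
  have [|c cX cE] := @IVT _ _ _ _ (pi / 2) Xx (cpsi x Xx).
    by rewrite ge_min psiX /= le_max px orbT.
  have := npi2 c; rewrite cE eqxx.
  by move: cX; rewrite in_itv /= => /andP[-> _] /(_ isT).
have spsi : sin (psi x) @[x --> +oo] --> 0.
  apply/cvgrPdist_le => e e0; have [M [Mr MP]] := (cvgrPdist_le _ _).1 s0 e e0.
  exists M; split=> // x /MP; rewrite !sub0r !normrN (_ : `|sin (psi x)| = `|sin (theta x)|)//.
  by apply/eqP; rewrite -(@eqrXn2 _ 2)// !real_normK ?num_real// psi2.
have asin0 : asin (0 : R) = 0.
  by rewrite -{1}(sin0 R) sinK// in_itv /=; apply/andP; split; lra.
have ppsi : psi x @[x --> +oo] --> 0.
  rewrite -asin0; have ca : {for 0, continuous (@asin R)}.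
    by apply: continuous_asin; rewrite ltrN10 ltr01.
  have h : asin (sin (psi x)) @[x --> +oo] --> asin 0 by exact: (continuous_cvg _ ca spsi).
  apply/cvgrPdist_le => e e0; have [M [Mr MP]] := (cvgrPdist_le _ _).1 h e e0.
  exists (Num.max M X); split=> [|x]; first exact: num_real.
  rewrite gt_max => /andP[/MP + /ltW/small]; rewrite ltr_norml => + /andP[/ltW a /ltW b].
  by rewrite sinK// in_itv /= a b.
have -> : theta = (fun x => psi x + k%:~R * pi) by apply/funext => x; rewrite subrK.
by rewrite -[X in _ --> X]add0r; apply: cvgD => //; exact: cvg_cst.
Qed.

Lemma Lfun_infty_bounded {R : realType} (f : R -> R) (C : R) :
  measurable_fun setT f -> (forall x, `|f x| <= C) -> f \in Lfun lebesgue_measure +oo%E.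
Proof.
move=> mf fC; rewrite inE; apply/andP; split; first by rewrite inE.
rewrite inE /= /finite_norm Lnorm.unlock; case: ifP => [_|_]; last exact: ltry.
apply: (@le_lt_trans _ _ C%:E); last exact: ltry.
by apply/ess_sup_inf.ess_supP; apply: aeW => x /=; rewrite lee_fin.
Qed.

(** Continuity bounds [theta] on a compact initial segment, the limit bounds it beyond. *)
Lemma cvg_pinfty_Lfun {R : realType} (theta : R -> R) (l : R) :
  {within Rplus_bar, continuous theta} -> measurable_fun Rplus theta ->
  theta x @[x --> +oo] --> l ->
  (theta \_ Rplus) \in Lfun lebesgue_measure +oo%E.
Proof.
move=> cth mt tl.
have [M [_ MP]] := (cvgrPdist_le _ _).1 tl 1 ltr01.
pose B := Num.max M 0.
have MB : M <= B by rewrite le_max lexx.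
have B0 : 0 <= B by rewrite le_max lexx orbT.
have [c _ cmax] : exists2 c, c \in `[0, B] & forall t, t \in `[0, B] -> `|theta t| <= `|theta c|.
  apply: (@EVT_max R (fun t => `|theta t|)) => //.
  have cB : {within `[0, B], continuous theta}.
    apply: continuous_subspaceW cth => t; rewrite /Rplus_bar /= !in_itv /= andbT.
    by move=> /andP[].
  by move=> t; apply: cvg_norm; exact: cB.
apply: (@Lfun_infty_bounded _ _ (Num.max (`|theta c|) (`|l| + 1))).
  exact/(measurable_restrictT _ _).1.
move=> x; rewrite patchE; case: ifPn => [/set_mem|_]; last first.
  by rewrite normr0 le_max normr_ge0.
rewrite RplusE => x0; rewrite le_max; have [xB|Bx] := leP x B.
  by rewrite cmax// in_itv /= (ltW x0).
apply/orP; right; have h := MP x (le_lt_trans MB Bx).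
have -> : theta x = l - (l - theta x) by ring.
by apply: (le_trans (ler_normB _ _)); rewrite lerD2l.
Qed.

(** * An admissible function vanishing at infinity *)

Section competitor.
Context {R : realType} (beta : R) (eta : R -> R).
Hypothesis heta : cutoff beta eta.

(** Dilating by [K] divides the derivative by [K] and spreads it over an interval of length [K], so
    the energy is of order [1 / K]. *)
Lemma cutoff_dilation_dirichlet : exists L : R, 0 <= L /\ forall M N : R, 0 < M -> 0 < N ->
  dirichlet (fun x => eta ((x - M) / M) - eta ((x - N) / N)) <= L * (M^-1 + N^-1).
Proof.
have [L [L0 eL]] := cutoff_derive1_bounded heta; have [se _ _ _ _] := heta.
exists (2 * L ^+ 2); split; first by rewrite mulr_ge0 ?sqr_ge0.
move=> M N M0 N0; have tMN := test_function_bump heta N0 M0 N0 M0.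
pose e (K x : R) := (L / K) ^+ 2 * \1_(`[K, K + K]%classic) x.
have e0 K x : 0 <= e K x by rewrite mulr_ge0 ?sqr_ge0// indicE.
have me K : measurable_fun Rplus (fun x => (e K x)%:E).
  by apply/measurable_EFinP; apply: measurable_funM.
have eD (K x : R) : 0 < K -> (K^-1 * derive1 eta ((x - K) / K)) ^+ 2 <= e K x.
  move=> K0; rewrite exprMn -(real_normK (num_real (derive1 eta _))).
  have -> : e K x = K^-1 ^+ 2 * (L ^+ 2 * \1_(`[K, K + K]%classic) x).
    by rewrite /e exprMn; ring.
  apply: ler_wpM2l; first exact: sqr_ge0.
  have := eL ((x - K) / K); rewrite !indicE.
  have -> : ((x - K) / K \in `[0%R, 1%R]%classic) = (x \in `[K, K + K]%classic).
    rewrite !mem_setE !in_itv /= pmulr_lge0 ?invr_gt0// subr_ge0.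
    by rewrite ler_pdivrMr// mul1r lerBlDr.
  case: (_ \in _); rewrite ?mulr1 ?mulr0.
    by move=> h; rewrite lerXn2r ?nnegrE.
  by rewrite normr_le0 => /eqP ->; rewrite normr0 expr0n.
have eI (K : R) : 0 < K -> (\int[leb]_(x in Rplus) (e K x)%:E <= (L ^+ 2 * K^-1)%:E)%E.
  move=> K0; under eq_integral do rewrite EFinM.
  rewrite ge0_integralZl//; [|exact/measurable_EFinP|by rewrite lee_fin sqr_ge0].
  rewrite integral_indic//.
  apply: (@le_trans _ _ (((L / K) ^+ 2)%:E * K%:E)%E).
    rewrite lee_wpmul2l ?lee_fin ?sqr_ge0//.
    apply: (@le_trans _ _ (leb `[K, K + K]%classic)).
      by apply: le_measure; rewrite ?inE//; exact: measurableI.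
    by rewrite lebesgue_measure_itv /= lte_fin ltrDl K0 -EFinB addrK.
  by rewrite -EFinM lee_fin le_eqVlt; apply/orP; left; apply/eqP; field; rewrite gt_eqF.
rewrite -lee_fin -dirichletE// /H10_normsq.
apply: (@le_trans _ _ (\int[leb]_(x in Rplus) (2%:E * (e M x)%:E + 2%:E * (e N x)%:E))%E).
  apply: ge0_le_integral => //.
  - by move=> x _; rewrite lee_fin sqr_ge0.
  - apply/measurable_EFinP; apply: measurable_funX; exact: measurable_derive1.
  - by apply: emeasurable_funD; apply: measurable_funeM; exact: me.
  move=> x _; rewrite -!EFinM -EFinD lee_fin.
  have -> : (fun x => eta ((x - M) / M) - eta ((x - N) / N)) =
      (fun x => 1 * eta ((x - M) / M) + (- 1) * eta ((x - N) / N)).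
    by apply/funext => y; rewrite mul1r mulN1r.
  have de := smooth_derivable se.
  rewrite derive1_lincomb; last 2 first.
  - by move=> y; apply: smooth_derivable; exact: smooth_affine.
  - by move=> y; apply: smooth_derivable; exact: smooth_affine.
  rewrite !derive1_affine// mul1r mulN1r.
  have := eD M x M0; have := eD N x N0.
  move: (M^-1 * _) (N^-1 * _) => p q; have := sqr_ge0 (p + q).
  by nra.
rewrite ge0_integralD//; last 4 first.
- by move=> x _; rewrite -EFinM lee_fin mulr_ge0.
- by apply: measurable_funeM; exact: me.
- by move=> x _; rewrite -EFinM lee_fin mulr_ge0.
- by apply: measurable_funeM; exact: me.
do 2 (rewrite ge0_integralZl//; [|exact: me|by move=> x _; rewrite lee_fin]).
have -> : (2 * L ^+ 2 * (M^-1 + N^-1))%:E =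
    (2%:E * (L ^+ 2 * M^-1)%:E + 2%:E * (L ^+ 2 * N^-1)%:E)%E.
  by rewrite -!EFinM -EFinD; congr EFin; ring.
by apply: leeD; rewrite lee_wpmul2l// eI.
Qed.

(** The constant [beta] is approximated by the dilations [eta ((x - k n) / k n)], equal to [beta] up
    to [k n] and of vanishing energy. The shift by 1 makes the competitor equal to [beta] near 0, so
    that its difference with a dilation is a test function. *)
Lemma competitor_admissible : admissible beta (fun x => eta ((x - 1) / 1)).
Proof.
have [se e01 e0 e1 _] := heta; have [L [L0 LP]] := cutoff_dilation_dirichlet.
split.
  by apply: continuous_subspaceT; apply: smooth_continuous; exact: smooth_affine.
pose k n : R := n.+2%:R; have k0 n : 0 < k n by rewrite ltr0n.
pose phi n x := eta ((x - 1) / 1) - eta ((x - k n) / k n).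
have tp n : test_function (phi n) by apply: (test_function_bump heta).
exists phi; split => //.
  apply/(H10_cauchyP tp) => e e00.
  have L1 : 0 < L + 1 by rewrite ltr_wpDl.
  have d0 : 0 < e / (2 * (L + 1)) by rewrite divr_gt0// mulr_gt0.
  have [N _ NP] := near_infty_natSinv_lt (PosNum d0).
  exists N => m n Nm Nn.
  have -> : phi m \- phi n = fun x => eta ((x - k n) / k n) - eta ((x - k m) / k m).
    by apply/funext => x; rewrite /phi /=; ring.
  apply: (le_lt_trans (LP _ _ (k0 n) (k0 m))).
  have kl i : (N <= i)%N -> (k i)^-1 < e / (2 * (L + 1)).
    move=> Ni; apply: le_lt_trans (NP i Ni).
    by rewrite lef_pV2 ?posrE ?ltr0n// ler_nat.
  have h1 := kl m Nm; have h2 := kl n Nn.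
  have kp i : 0 < (k i)^-1 by rewrite invr_gt0.
  have : L * ((k n)^-1 + (k m)^-1) <= (L + 1) * ((k n)^-1 + (k m)^-1).
    by rewrite ler_wpM2r ?lerDl// addr_ge0// ltW.
  move=> /le_lt_trans; apply.
  have -> : e = (L + 1) * (e / (2 * (L + 1)) + e / (2 * (L + 1))).
    by field; rewrite gt_eqF.
  by rewrite ltr_pM2l// ltrD.
move=> x x0; apply: cvg_near_cst.
exists (Num.truncn x) => // n /= xn; rewrite /phi (e0 ((x - k n) / k n))//.
rewrite pmulr_lle0 ?invr_gt0// subr_le0; apply: ltW.
by apply: (lt_le_trans (truncnS_gt x)); rewrite /k ler_nat ltnS ltnW.
Qed.

Lemma competitor_cvg : eta ((x - 1) / 1) @[x --> +oo] --> (0 : R).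
Proof.
have [se e01 e0 e1 _] := heta; apply: cvg_near_cst.
by exists 2; split; [exact: num_real|move=> x x2; rewrite e1// divr1; lra].
Qed.

End competitor.

(** * Existence of a minimizer *)

(** The inequality [l <= limn_einf u] tested on real levels: this form adds up directly, and its
    failure yields one level not exceeded at infinitely many indices. *)
Definition lsc_along {R : realType} (l : \bar R) (u : (\bar R)^nat) : Prop :=
  forall a : R, (a%:E < l)%E -> \forall n \near \oo, (a%:E < u n)%E.

(** A level below the sum is split into a level below each term. When one term is infinite it takes
    the excess, and nonnegativity leaves room for a level below the other. *)
Lemma lsc_alongD {R : realType} (l1 l2 : \bar R) (u1 u2 : (\bar R)^nat) :
  (0 <= l1)%E -> (0 <= l2)%E -> lsc_along l1 u1 -> lsc_along l2 u2 ->
  lsc_along (l1 + l2)%E (fun n => u1 n + u2 n)%E.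
Proof.
move=> l10 l20 h1 h2 a al.
have [b [c [bl cl abc]]] : exists b c : R, [/\ (b%:E < l1)%E, (c%:E < l2)%E & a <= b + c].
  case: l1 l10 al {h1} => [p p0|_ _|//]; last first.
    exists (a + 1), (- 1); split; rewrite ?ltry//; last by lra.
    by apply: lt_le_trans l20; rewrite lte_fin oppr_lt0.
  case: l2 l20 {h2} => [q q0|_ _|//].
    rewrite -EFinD lte_fin => apq; exists (p - (p + q - a) / 2), (q - (p + q - a) / 2).
    by rewrite !lte_fin; split; lra.
  exists (p - 1), (a + 1 - p); rewrite lte_fin ltry; split => //; lra.
have [N _ NP] := filterI (h1 _ bl) (h2 _ cl); exists N => // n /NP[bn cn].
by apply: (@le_lt_trans _ _ (b%:E + c%:E)%E); [rewrite -EFinD lee_fin|exact: lteD].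
Qed.

Lemma lsc_along_limn_einf {R : realType} (l : \bar R) (u : (\bar R)^nat) :
  (l <= limn_einf u)%E -> lsc_along l u.
Proof. by move=> lu a al; apply: limn_einf_gt_near; exact: lt_le_trans lu. Qed.

Lemma lsc_alongZ {R : realType} (k : R) (l : \bar R) (u : (\bar R)^nat) :
  0 < k -> lsc_along l u -> lsc_along (k%:E * l)%E (fun n => k%:E * u n)%E.
Proof.
move=> k0 h a al; have ak : ((k^-1 * a)%:E < l)%E.
  by rewrite EFinM lte_pdivrMl.
by have [N _ NP] := h _ ak; exists N => // n /NP; rewrite EFinM lte_pdivrMl.
Qed.

Lemma hoelder_continuous {R : realType} (f : R -> R) (K : R) : 0 <= K ->
  (forall x y, 0 <= x -> 0 <= y -> `|f x - f y| <= K * Num.sqrt `|x - y|) ->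
  {within Rplus_bar, continuous f}.
Proof.
move=> K0 fK; apply/subspace_continuousP => x.
rewrite /Rplus_bar /= in_itv /= andbT => x0; apply/cvgrPdist_le => e e0.
have K1 : 0 < K + 1 by rewrite ltr_wpDl.
have q0 : 0 < e / (K + 1) by rewrite divr_gt0.
have d0 : 0 < (e / (K + 1)) ^+ 2 by rewrite exprn_gt0.
have := nbhsx_ballx x _ d0; apply: filterS => y xy /=; rewrite in_itv /= andbT => y0.
apply: (le_trans (fK x y x0 y0)).
have h : Num.sqrt `|x - y| <= e / (K + 1).
  by rewrite -[leRHS]gtr0_norm// -[leRHS]sqrtr_sqr; apply: ler_wsqrtr; exact: ltW.
apply: (@le_trans _ _ (K * (e / (K + 1)))); first by rewrite ler_wpM2l.
by rewrite mulrCA ger_pMr// ler_pdivrMr// mul1r lerDl.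
Qed.

Section minimizer.
Context {R : realType} (beta nu : R) (eta : R -> R).
Hypotheses (beta0 : 0 < beta) (nu0 : 0 < nu) (heta : cutoff beta eta).

(** If some level [a < wdsq theta] were not eventually exceeded, infinitely many [phi n] would have
    energy at most [a + e / 2]. The sequence from [mazur] has the same limit and energy eventually
    at most [a + e], so [wdsq theta <= a + e] for every [e]. The same sequence witnesses [H10]. *)
Lemma wdsq_lsc (th phi : nat -> R -> R) (theta : R -> R) (M : R) :
  measurable_fun Rplus theta ->
  (forall n, test_function (phi n)) -> (forall n, dirichlet (phi n) <= M) ->
  (forall n, ((dirichlet (phi n))%:E <= wdsq (th n) + n.+1%:R^-1%:E)%E) ->
  (forall x, 0 <= x -> phi n x @[n --> \oo] --> theta x - beta) ->
  lsc_along (wdsq theta) (fun n => wdsq (th n)) /\ H10 (fun x => theta x - beta).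
Proof.
move=> mt tp pM pth plim; have [w [hw wP]] := mazur tp pM plim.
split; last by exists w.
move=> a al; apply: contrapT => nev.
have freq N : exists2 n, (N <= n)%N & (wdsq (th n) <= a%:E)%E.
  apply: contrapT => H; apply: nev; exists N; [by []|move=> n Nn].
  by rewrite ltNge; apply/negP => na; apply: H; exists n.
have a0 : 0 <= a.
  by have [n _ na] := freq 0%N; rewrite -lee_fin; apply: le_trans na; exact: wdsq_ge0.
move: al; apply/negP; rewrite -leNgt; apply/lee_addgt0Pr => e e0.
have e2 : 0 < e / 2 by rewrite divr_gt0.
have [N _ NP] := near_infty_natSinv_lt (PosNum e2).
have le2 n : (N <= n)%N -> n.+1%:R^-1 <= e / 2 by move=> Nn; apply: ltW; exact: NP.
have fr n : exists2 k, (n <= k)%N & dirichlet (phi k) <= a + e / 2.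
  have [k nk ka] := freq (maxn n N).
  exists k; first by apply: leq_trans nk; exact: leq_maxl.
  rewrite -lee_fin EFinD; apply: (le_trans (pth k)); apply: leeD => //.
  by rewrite lee_fin le2// (leq_trans _ nk)// leq_maxr.
rewrite -EFinD; apply: (wdsq_le beta0 heta hw mt); first by rewrite addr_ge0// ltW.
move=> n; exists (maxn n N); first exact: leq_maxl.
apply: (le_trans (wP _ fr _)); rewrite [e in leRHS]splitr addrA lerD2l.
by apply: le2; exact: leq_maxr.
Qed.

Lemma minimizer : exists theta : R -> R, [/\ admissible beta theta,
    forall theta', admissible beta theta' ->
      (renormalized_energy beta nu eta theta <= renormalized_energy beta nu eta theta')%E &
    exists k : int, theta x @[x --> +oo] --> (k%:~R * pi : R)].
Proof.
have [H H0 potH] := potential_lower_bound nu0 heta.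
pose J := positive_energy beta nu H eta.
have k0 : 0 < nu / (8 * pi) by rewrite divr_gt0// mulr_gt0// pi_gt0.
have W0 (th : R -> R) : (0 <= (2^-1)%:E * wdsq th)%E by rewrite mule_ge0 ?lee_fin// wdsq_ge0.
have P0 th : (0 <= potential_energy beta nu H eta th)%E by exact: potential_energy_ge0.
have N0 th : (0 <= (nu / (8 * pi))%:E * nonlocal_energy beta th)%E.
  by rewrite mule_ge0 ?lee_fin ?(ltW k0)// nonlocal_energy_ge0.
have J0 th : (0 <= J th)%E by apply: adde_ge0 => //; exact: adde_ge0.
(* The terms separating the renormalized energy from [J] are the same for all admissible functions,
   and subtracting them preserves the order. *)
suff [theta [ath Jmin lim]] : exists theta : R -> R, [/\ admissible beta theta,
    forall theta', admissible beta theta' -> (J theta <= J theta')%E &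
    exists k : int, theta x @[x --> +oo] --> (k%:~R * pi : R)].
  exists theta; split; [exact: ath|move=> th' ath'|exact: lim].
  have E := renormalized_energyE beta0 heta H0 potH.
  rewrite (E _ ath) (E _ ath').
  by apply: leeB; [apply: leeB; [exact: Jmin|exact: lexx]|exact: lexx].
pose m := ereal_inf (J @` admissible beta).
have mJ th : admissible beta th -> (m <= J th)%E.
  by move=> ath; apply: ereal_inf_lbound; exists th.
have m0 : (0 <= m)%E by apply: le_ereal_inf_tmp => _ [th _ <-]; exact: J0.
(* If the infimum is [+oo] every admissible function is a minimizer, so finiteness of the
   energy need not be checked on any competitor. *)
have [mfin|minf] := ltP m +oo%E; last first.
  exists (fun x => eta ((x - 1) / 1)); split.
  - exact: competitor_admissible heta.
  - move=> th ath; apply: (@le_trans _ _ +oo%E); first exact: leey.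
    by apply: le_trans minf _; exact: mJ.
  - by exists 0; rewrite mulr0z mul0r; exact: competitor_cvg heta.
have mE : m = (fine m)%:E by rewrite fineK// ge0_fin_numE.
set r := fine m in mE; have r0 : 0 <= r by exact: fine_ge0.
have i0 n : 0 < n.+1%:R^-1 :> R by rewrite invr_gt0.
have /choice[th thP] : forall n : nat, exists th, admissible beta th /\
    (J th < (r + n.+1%:R^-1)%:E)%E.
  move=> n; have := @lb_ereal_inf_adherent R (J @` admissible beta) _ (i0 n).
  rewrite -/m => -[|_ [th ath <-] lt]; first by rewrite ge0_fin_numE.
  by exists th; split => //; rewrite EFinD -mE.
have mth n : measurable_fun Rplus (th n) by exact: admissible_measurable (proj1 (thP n)).
have /choice[phi phiP] : forall n, exists phi, [/\ test_function phi,
    forall x, 0 <= x -> (phi x - (th n x - beta)) ^+ 2 <= x * n.+1%:R^-1 &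
    ((dirichlet phi)%:E <= wdsq (th n) + n.+1%:R^-1%:E)%E].
  move=> n; have [[_ [psi hpsi]] _] := thP n.
  exact: (h10_seq_approx beta0 heta hpsi (mth n) (i0 n)).
(* From [J (th n) <= r + 1] and the factor [2^-1] of the gradient term,
   [wdsq (th n) <= 2 * (r + 1)]; the last 1 bounds the approximation error. *)
pose M := 2 * (r + 1) + 1.
have i1 n : n.+1%:R^-1 <= 1 :> R by rewrite invf_le1 ?ltr0n// ler1n.
have pM n : dirichlet (phi n) <= M.
  have [_ _ pn] := phiP n; rewrite -lee_fin; apply: (le_trans pn); rewrite /M EFinD.
  apply: leeD; last by rewrite lee_fin.
  rewrite EFinM -lee_pdivrMl//.
  apply: (@le_trans _ _ (J (th n))).
    by rewrite /J /positive_energy -addeA leeDl// adde_ge0.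
  by apply: le_trans (ltW (proj2 (thP n))) _; rewrite lee_fin lerD2l.
have M0 : 0 <= M by apply: le_trans (pM 0%N); exact: dirichlet_ge0.
pose K := Num.sqrt M; have K0 : 0 <= K by exact: sqrtr_ge0.
have pK n x y : 0 <= x -> 0 <= y -> `|phi n x - phi n y| <= K * Num.sqrt `|x - y|.
  move=> _ _; have [tp _ _] := phiP n; have := dirichlet_hoelder x y tp => h.
  rewrite -sqrtrM// -sqrtr_sqr; apply: ler_wsqrtr; apply: le_trans h _.
  by rewrite mulrC ler_wpM2r.
have p0 n : phi n 0 = 0 by apply: test_function0; have [] := phiP n.
have [s [u [sk ulim]]] := pointwise_extraction p0 pK K0.
pose theta x := u x + beta.
have uK x y : 0 <= x -> 0 <= y -> `|theta x - theta y| <= K * Num.sqrt `|x - y|.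
  move=> x0 y0; have -> : theta x - theta y = u x - u y by rewrite /theta; ring.
  have : `|phi (s k) x - phi (s k) y| @[k --> \oo] --> `|u x - u y|.
    by apply: cvg_norm; apply: cvgB; exact: ulim.
  by move=> /cvgr_to_le; apply; apply: nearW => k; exact: pK.
have cth : {within Rplus_bar, continuous theta} by exact: hoelder_continuous K0 uK.
have mt := within_Rplus_bar_measurable cth.
(* Since [k <= s k], errors along the subsequence are controlled by the index [k]. *)
have is_le k : (s k).+1%:R^-1 <= k.+1%:R^-1 :> R.
  by rewrite lef_pV2 ?posrE ?ltr0n// ler_nat ltnS.
have thlim x : 0 <= x -> th (s k) x @[k --> \oo] --> theta x.
  move=> x0; pose d k := phi (s k) x - (th (s k) x - beta).
  have d0 : d k @[k --> \oo] --> 0.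
    have q0 : Num.sqrt (x * k.+1%:R^-1) @[k --> \oo] --> 0.
      rewrite -[X in _ --> X](sqrtr0 R) -(mulr0 x).
      apply: (continuous_cvg _ (@sqrt_continuous R _)).
      by apply: cvgM; [exact: cvg_cst|exact: cvg_harmonic].
    apply/cvgrPdist_le => e e0; have [N _ NP] := (cvgrPdist_le _ _).1 q0 e e0.
    exists N => // k /NP; rewrite !sub0r !normrN; apply: le_trans.
    apply: le_trans (ler_norm _); rewrite -sqrtr_sqr; apply: ler_wsqrtr.
    have [_ pk _] := phiP (s k); apply: (le_trans (pk x x0)).
    by rewrite ler_wpM2l.
  have -> : (fun k => th (s k) x) = (fun k => phi (s k) x + beta - d k).
    by apply/funext => k; rewrite /d; ring.
  rewrite -[X in _ --> X]subr0; apply: cvgB => //.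
  by apply: cvgD; [exact: ulim|exact: cvg_cst].
have [Wlsc hH10] : lsc_along (wdsq theta) (fun k => wdsq (th (s k))) /\
    H10 (fun x => theta x - beta).
  apply: (@wdsq_lsc (fun k => th (s k)) (fun k => phi (s k)) theta M mt).
  - by move=> k; have [] := phiP (s k).
  - by move=> k; exact: pM.
  - move=> k; have [_ _ pk] := phiP (s k); apply: (le_trans pk).
    by rewrite leeD2l// lee_fin.
  - move=> x x0; have -> : theta x - beta = u x by rewrite /theta addrK.
    exact: ulim.
have ath : admissible beta theta by split.
have Jlsc : lsc_along (J theta) (fun k => J (th (s k))).
  apply: lsc_alongD => //; first by rewrite adde_ge0.
    apply: lsc_alongD => //; first by apply: lsc_alongZ.
    apply: lsc_along_limn_einf; apply: (potential_energy_fatou heta potH) => //.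
    by move=> x x0; apply: thlim; exact: ltW.
  apply: lsc_alongZ => //; apply: lsc_along_limn_einf; apply: nonlocal_energy_fatou => //.
  by move=> x x0; apply: thlim; exact: ltW.
have Jr : (J theta <= r%:E)%E.
  apply/lee_addgt0Pr => e e0; rewrite leNgt -EFinD; apply/negP => /Jlsc [N1 _ N1P].
  have [N2 _ N2P] := near_infty_natSinv_lt (PosNum e0).
  pose k := maxn N1 N2.
  have := N1P k (leq_maxl _ _); apply/negP; rewrite -leNgt.
  apply: (le_trans (ltW (proj2 (thP (s k))))); rewrite lee_fin lerD2l.
  by apply: (le_trans (is_le k)); apply: ltW; apply: N2P; exact: leq_maxr.
exists theta; split; first exact: ath.
  by move=> th' ath'; apply: (le_trans Jr); rewrite -mE; exact: mJ.
apply: sin_cvg0_cvg_pi => //; apply: (hoelder_sin_cvg0 K0 uK mt).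
(* The other two terms of [J] are nonnegative, so the potential term is finite; by [potH] it
   dominates a quarter of the integral of [sin (theta x) ^+ 2]. *)
have Pfin : (potential_energy beta nu H eta theta < +oo)%E.
  apply: (@le_lt_trans _ _ (J theta)); last by apply: le_lt_trans Jr _; exact: ltry.
  by rewrite /J /positive_energy addeAC leeDr// adde_ge0.
have ms : measurable_fun Rplus (fun x => (sin (theta x) ^+ 2)%:E).
  by apply/measurable_EFinP; apply: measurable_funX; exact: measurable_sin_comp.
have : ((4^-1)%:E * \int[leb]_(x in Rplus) (sin (theta x) ^+ 2)%:E < +oo)%E.
  rewrite -ge0_integralZl//; [|by move=> x _; rewrite lee_fin sqr_ge0].
  apply: le_lt_trans Pfin; apply: ge0_le_integral => //.
  - by move=> x _; rewrite -EFinM lee_fin mulr_ge0// sqr_ge0.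
  - exact: measurable_funeM.
  - by apply/measurable_EFinP; exact: (measurable_potentialH _ _ heta mt).
  by move=> x; rewrite RplusE -EFinM lee_fin => x0; exact: potH.
by rewrite lte_pdivrMl// mulry gtr0_sg// mul1e.
Qed.

End minimizer.

Theorem theorem1 (R : realType) (beta nu : R) (eta : R -> R)
  (hbeta0 : 0 < beta) (hbeta : beta <= pi / 2) (hnu : 0 < nu)
  (heta : cutoff beta eta) :
  exists theta : R -> R,
    [/\ admissible beta theta,
        renormalized_energy beta nu eta theta =
          ereal_inf [set renormalized_energy beta nu eta theta'
                    | theta' in admissible beta],
        (theta \_ Rplus) \in Lfun lebesgue_measure +oo%E &
        exists k : int, theta x @[x --> +oo] --> (k%:~R * pi : R)].
Proof.
have [theta [ath Emin [k lim]]] := minimizer hbeta0 hnu heta.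
exists theta; split; [exact: ath| | |by exists k].
- apply/eqP; rewrite eq_le; apply/andP; split.
    by apply: le_ereal_inf_tmp => _ [th' ath' <-]; exact: Emin.
  by apply: ereal_inf_lbound; exists theta.
- exact: cvg_pinfty_Lfun (proj1 ath) (admissible_measurable ath) lim.
Qed.
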